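(* Let $G$ be an infinite, connected, locally finite, quasi-transitive, simple rooted graph with root $\mathbf{0}$. Suppose that $G$ has a square graph height function $(h,\mathcal H,\rho)$ and sub-exponential growth. For $n\ge 3$, let $p_n$ be the number of $n$-step polygons of $G$ containing $\mathbf 0$, and let $\pi(G):=\limsup_{n\to\infty}p_n^{1/n}$. Let $\mu(G)$ be the connective constant and $\beta(G)$ the bridge constant of $G$. (a) We have that $\pi(G)=\beta(G)=\mu(G)$. (b) Furthermore, for every $\epsilon>0$, there exists an arithmetic sequence $(m_N:N\ge1)$ of positive integers with positive common difference such that $$\liminf_{N\to\infty}p_{m_N}^{1/m_N}\ge\beta(G)-\epsilon.$$
   Context: Graphs $G=(V,E)$ are simple (no loops, no parallel edges), with root $\mathbf{0}\in V$. Write $u\sim v$ if $u,v$ are neighbours, $\partial v$ for the set of neighbours of $v$, and $d(u,v)$ for graph-distance. $\mathrm{Aut}(G)$ is the automorphism group. A subgroup of $\mathrm{Aut}(G)$ acts quasi-transitively if its action on $V$ has finitely many orbits; $G$ is quasi-transitive if $\mathrm{Aut}(G)$ acts quasi-transitively. A self-avoiding walk (SAW) is a path that visits no vertex more than once; it has $n$ steps if it has exactly $n$ edges. $c_n$ is the number of $n$-step SAWs starting at $\mathbf{0}$, and the connective constant is $\mu(G):=\lim_{n\to\infty}c_n^{1/n}$ (the limit is known to exist and does not depend on the choice of root). A polygon is a cycle of $G$ (with at least 3 distinct vertices, no repeated vertex, regarded as unoriented) containing $\mathbf{0}$; it has $n$ steps if it has exactly $n$ edges. Thus $2p_n$ is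 the number of $(n-1)$-step SAWs from $\mathbf{0}$ ending at a neighbour of $\mathbf{0}$ ($n\ge3$). A graph height function (ghf) on $G$ is a pair $(h,\mathcal H)$ such that: (a) $h:V\to\mathbb Z$ and $h(\mathbf 0)=0$; (b) $\mathcal H\le\mathrm{Aut}(G)$ acts quasi-transitively on $G$ and $h(\alpha v)-h(\alpha u)=h(v)-h(u)$ for all $\alpha\in\mathcal H$, $u,v\in V$; (c) for every $v\in V$ there exist $u,w\in\partial v$ with $h(u)<h(v)<h(w)$. If $(h,\mathcal H)$ is a ghf then so is $(-h,\mathcal H)$. A square graph height function (square ghf) is a triple $(h,\mathcal H,\rho)$ where $(h,\mathcal H)$ is a ghf and $\rho\in\mathcal H$ satisfies: (a) $\rho$ is a translation, i.e. there is no non-empty finite set $F\subseteq V$ with $\rho(F)=F$; (b) $h(\rho(v))=h(v)$ for all $v\in V$; (c) $\rho$ commutes with every $\alpha\in\mathcal H$. Given a ghf $(h,\mathcal H)$, an $h$-bridge is a SAW $(v_0,v_1,\dots,v_n)$ on $G$ with $h(v_0)<h(v_m)\le h(v_n)$ for $0<m\le n$. Let $b_n$ be the number of $n$-step $h$-bridges with $v_0=\mathbf 0$. The limit $\beta(h):=\lim_{n\to\infty}b_n^{1/n}$ is known to exist. The bridge constant $\beta(G)$ is defined as the common value of $\beta(h)$ and $\beta(-h)$ if $\mathcal H$ is unimodular (these are known to be equal in that case), and as $\max\{\beta(h),\beta(-h)\}$ otherwise; it is known not to depend on the choice of ghf or root. Sub-exponential growth means $\lim_{n\to\infty}\frac1n\log\Gamma_n=0$,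 where $\Gamma_n=|\{v\in V:d(\mathbf 0,v)\le n\}|$. *)

(* Defs.v *)
From HB Require Import structures.
From mathcomp Require Import all_boot all_order all_algebra finmap.
From mathcomp Require Import all_classical all_reals all_analysis.

Set Implicit Arguments.
Unset Strict Implicit.
Unset Printing Implicit Defensive.

Import Order.TTheory GRing.Theory Num.Theory.
Import numFieldNormedType.Exports.

Local Open Scope classical_set_scope.
Local Open Scope ring_scope.

Record graph := Graph {
  vertex :> choiceType;
  adj : rel vertex;
  adj_sym : symmetric adj;
  adj_irr : irreflexive adj }.

(* [fset_set] sends infinite sets to the empty one, so [ncard] is 0 on them;
   it is only applied to sets that are finite in a locally finite graph. *)
Definition ncard (T : choiceType) (A : set T) : nat := #|` fset_set A|%fset.

Section Graph.
Variable G : graph.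
Implicit Types (u v o : G) (p : seq G) (n : nat) (H : set (G -> G))
  (h : G -> int) (rho : G -> G).

Definition locally_finite := forall v, finite_set [set u | adj v u].

Definition connected_graph :=
  forall u v, exists p, path (@adj G) u p /\ last u p = v.

(* Default value 0 when u and v lie in different components. *)
Definition graph_dist u v : nat :=
  xget 0%N [set n | (exists p, [/\ path (@adj G) u p, last u p = v & size p = n])
    /\ forall p, path (@adj G) u p -> last u p = v -> (n <= size p)%N].

Definition ball_card o n : nat := ncard [set v | (graph_dist o v <= n)%N].

Definition subexponential_growth (R : realType) o :=
  (fun n => n%:R^-1 * ln ((ball_card o n)%:R : R)) @ \oo --> (0 : R).

Definition automorphism (f : G -> G) :=
  bijective f /\ forall u v, adj (f u) (f v) = adj u v.

Definition aut_subgroup H :=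
  [/\ H `<=` automorphism,
      H id,
      (forall f g, H f -> H g -> H (f \o g)) &
      (forall f, H f -> exists g, [/\ H g, cancel f g & cancel g f])].

Definition orbit H v : set G := [set f v | f in H].

Definition quasi_transitively_acting H := finite_set (range (orbit H)).

Definition quasi_transitive := quasi_transitively_acting automorphism.

Definition stabiliser H u : set (G -> G) := [set f | H f /\ f u = u].

(* Combinatorial form (Schlichting, Trofimov) of unimodularity of the closure
   of H in the topology of pointwise convergence. *)
Definition unimodular H :=
  forall u v, orbit H u v ->
    ncard (orbit (stabiliser H u) v) = ncard (orbit (stabiliser H v) u).

(* A walk (v_0, ..., v_n) is represented by its initial vertex v_0 and the
   sequence [:: v_1; ...; v_n]. *)
Definition saws v n : set (seq G) :=
  [set p | [/\ size p = n, path (@adj G) v p & uniq (v :: p)]].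

Definition bridges h v n : set (seq G) :=
  [set p | saws v n p /\
     forall x, x \in p -> (h v < h x) && (h x <= h (last v p))].

(* For a duplicate-free c with at least three items, [cycle_edges c] determines
   c exactly up to rotation and reversal, whence unoriented unrooted cycles. *)
Definition cycle_edges (c : seq G) : {fset {fset G}} :=
  [fset [fset x; next c x]%fset | x in c]%fset.

Definition polygons o n : set {fset {fset G}} :=
  [set P | exists c : seq G,
     [/\ (3 <= n)%N, size c = n, uniq c, cycle (@adj G) c &
         o \in c /\ P = cycle_edges c]].

Definition nroot (R : realType) (k n : nat) : R := k%:R `^ (n%:R^-1).

Definition connective_constant (R : realType) o : R :=
  limn (fun n => nroot R (ncard (saws o n)) n).

Definition polygon_root (R : realType) o n : R :=
  nroot R (ncard (polygons o n)) n.

Definition polygon_constant (R : realType) o : \bar R :=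
  limn_esup (fun n => (polygon_root R o n)%:E).

Definition bridge_growth (R : realType) o h : R :=
  limn (fun n => nroot R (ncard (bridges h o n)) n).

(* In the unimodular case the growth rates of h- and (-h)-bridges coincide. *)
Definition bridge_constant (R : realType) o h H : R :=
  if `[< unimodular H >] then bridge_growth R o h
  else Num.max (bridge_growth R o h) (bridge_growth R o (fun v => - h v)).

Definition graph_height_function o h H :=
  [/\ h o = 0,
      aut_subgroup H,
      quasi_transitively_acting H,
      (forall f u v, H f -> h (f v) - h (f u) = h v - h u) &
      (forall v, exists u w, [/\ adj v u, adj v w, h u < h v & h v < h w])].

Definition translation rho :=
  ~ exists F : set G, [/\ finite_set F, F !=set0 & rho @` F = F].

Definition square_graph_height_function o h H rho :=
  [/\ graph_height_function o h H,
      H rho,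
      translation rho,
      (forall v, h (rho v) = h v) &
      (forall f, H f -> f \o rho = rho \o f)].

End Graph.

(* Sequences are indexed from N = 1; the value at 0 is irrelevant. *)
Definition positive_arithmetic_sequence (m : nat -> nat) :=
  exists2 d : nat, (0 < d)%N &
    forall N, (1 <= N)%N -> (0 < m N)%N /\ m N.+1 = (m N + d)%N.

(* Main.v *)
Require Import Defs.
From HB Require Import structures.
From mathcomp Require Import all_boot all_order all_algebra finmap.
From mathcomp Require Import all_classical all_reals all_analysis.
From mathcomp Require Import zify ring lra.

Set Implicit Arguments.
Unset Strict Implicit.
Unset Printing Implicit Defensive.

Import Order.TTheory GRing.Theory Num.Theory.
Import numFieldNormedType.Exports.

Local Open Scope classical_set_scope.
Local Open Scope ring_scope.

(** Fix the root [o]. From any vertex a bridge of bounded length leads into the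
    orbit of [o] ([bridge_to_orbit]), where an image of any bridge from [o] can
    be attached. So the numbers of bridges are supermultiplicative up to a shift
    of the length, and they have an exponential rate [b]
    ([bridges_supermultiplicative], [bridge_rate_exists]).

    Sub-exponential growth enters by the pigeonhole principle: up to a factor
    that grows more slowly than any exponential, the bridges of a given length,
    after a bounded extension, end at one point [a o] with [a] in [H]
    ([many_periods]). Read from their common end, and preceded by one step from
    above it, such bridges are bridges for [- h] ([periods_reverse]). Hence [h]
    and [- h] have the same rate [b], and both branches in the definition of the
    bridge constant equal [b].

    That walks have the same rate is the argument of Hammersley and Welsh. A
    walk is cut at its last lowest point into two half-space walks, and a
    half-space walk is cut at successive extremal points into bridges,
    alternately for [h] and [- h], of strictly decreasing spans. If [B a] is the
    generating function of bridges of span [a] at a point [z < 1 / b], the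
    contribution of half-space walks is at most the product of the [1 + B a],
    hence at most [exp (\sum_a B a)], which is finite ([half_space_walks_bound],
    [saws_growth_le]).

    A polygon opened at [o] is a walk, so the rate of polygons is at most [b].
    Conversely, bridges from [o] to the same point [a o] can be chained: a chain
    of [N] of them leads from [o] to [a ^ N o], and since [rho] commutes with
    [a] and preserves [h], its image under a large power of [rho] is a disjoint
    chain at the same heights ([chains_disjoint]). The two chains are joined by
    a fixed path below [o] and by the image under [a ^ N] of a fixed path above
    [o] ([over_path]). This makes polygons whose lengths form an arithmetic
    sequence in [N] and whose numbers grow at a rate as close to [b] as desired
    ([polygons_from_chains], [polygon_rate]). *)

(** * Counting finite sets *)
Lemma ncard_inj (T U : choiceType) (A : set T) (B : set U) (f : T -> U) : finite_set B ->
  (forall x, A x -> B (f x)) ->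
  (forall x y, A x -> A y -> f x = f y -> x = y) -> (ncard A <= ncard B)%N.
Proof.
move=> finB AB inj; rewrite /ncard {1}/fset_set.
case: pselect => [finA|_]; last by rewrite cardfs0.
case: cid => F /= AF; rewrite AF /= in AB inj *.
rewrite -(card_in_imfset (f := f) imfset_key (p := mem F)) /=; last first.
  by move=> x y xF yF; apply: inj.
apply: fsubset_leq_card; apply/fsubsetP => _ /imfsetP[x /= xA ->].
by rewrite in_fset_set// inE; apply: AB.
Qed.

Lemma ncard_gt0 (T : choiceType) (A : set T) : finite_set A ->
  A !=set0 -> (0 < ncard A)%N.
Proof.
move=> finA [x Ax]; rewrite /ncard cardfs_gt0; apply/fset0Pn; exists x.
by rewrite in_fset_set// inE.
Qed.
Lemma ncard_fibers (T U : choiceType) (A : set T) (B : set U) (f : T -> U) :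
    finite_set A -> finite_set B ->
  (forall x, A x -> B (f x)) ->
  ncard A = (\sum_(b <- fset_set B) ncard (A `&` [set x | f x = b]))%N.
Proof.
move=> finA finB AB; rewrite {1}/ncard.
pose F b := fset_set (A `&` [set x | f x = b]).
have inF b x : (x \in F b) = (x \in A) && (f x == b).
  rewrite in_fset_set; last exact: finite_setIl.
  apply/idP/idP => [/set_mem[Ax /= /eqP fx]|/andP[/set_mem Ax /eqP fx]].
    by rewrite fx andbT; exact/mem_set.
  exact/mem_set.
have -> : fset_set A = (\bigcup_(b <- fset_set B) F b)%fset.
  apply/fsetP => x; rewrite in_fset_set//; apply/idP/bigfcupP.
    rewrite inE => Ax; exists (f x); last by rewrite inF eqxx andbT mem_set.
    by rewrite andbT in_fset_set// inE; exact: AB.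
  by move=> [b _]; rewrite inF => /andP[].
rewrite card_fset_sum1 partition_disjoint_bigfcup; last first.
  move=> b c _ _ /negP bc; apply/fdisjointP => x.
  rewrite inF => /andP[_ /eqP fx]; apply/negP; rewrite inF => /andP[_].
  by rewrite fx; exact: bc.
by apply: eq_bigr => b _; rewrite -card_fset_sum1.
Qed.

Lemma ncardX (T U : choiceType) (A : set T) (B : set U) :
  finite_set A -> finite_set B -> ncard (A `*` B) = (ncard A * ncard B)%N.
Proof.
move=> finA finB.
rewrite (ncard_fibers (finite_setX finA finB) finA (f := fst)); last first.
  by move=> [x y] [].
rewrite -[RHS]mulnC -[X in (_ * X)%N]count_predT -iter_addn_0 -big_const_seq.
rewrite !big_seq; apply: eq_bigr => a; rewrite in_fset_set// inE => Aa.
apply/eqP; rewrite eqn_leq; apply/andP; split.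
  apply: (ncard_inj (f := snd)) => // [[x y] [[]]//|].
  by move=> [x y] [x' y'] [_ /= ->] [_ /= ->] ->.
apply: (ncard_inj (f := pair a)) => // [|y y' _ _ [//]].
by apply: finite_setIl; exact: finite_setX.
Qed.

Lemma ncardX_inj (T U V : choiceType) (A : set T) (B : set U) (C : set V)
    (f : T * U -> V) : finite_set A -> finite_set B ->
  finite_set C -> (forall x y, A x -> B y -> C (f (x, y))) ->
  (forall x y x' y', A x -> B y -> A x' -> B y' ->
     f (x, y) = f (x', y') -> x = x' /\ y = y') ->
  (ncard A * ncard B <= ncard C)%N.
Proof.
move=> finA finB finC ABC inj; rewrite -ncardX//.
apply: (ncard_inj (f := f)) => //= [[x y] [/= Ax By]|]; first exact: ABC.
by move=> [x y] [x' y'] [/= Ax By] [/= Ax' By'] /inj[]// -> ->.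
Qed.

Lemma ncard_le_fibers (R : realType) (T U : choiceType) (A : set T)
    (B : set U) (f : T -> U) (M : R) :
  finite_set A -> finite_set B -> (forall x, A x -> B (f x)) ->
  (forall b, B b -> (ncard (A `&` [set x | f x = b]))%:R <= M) ->
  (ncard A)%:R <= (ncard B)%:R * M.
Proof.
move=> finA finB AB leM; rewrite (ncard_fibers finA finB AB) natr_sum.
rewrite (le_trans (y := \sum_(b <- fset_set B) M))//.
  rewrite !big_seq ler_sum// => b; rewrite in_fset_set// inE; exact: leM.
by rewrite big_const_seq count_predT iter_addr_0 /ncard mulr_natl.
Qed.

Lemma ncard_pigeonhole (T U : choiceType) (A : set T) (B : set U)
    (f : T -> U) : finite_set A -> finite_set B ->
  (forall x, A x -> B (f x)) -> A !=set0 ->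
  exists2 b, B b & (ncard A <= ncard B * ncard (A `&` [set x | f x = b]))%N.
Proof.
move=> finA finB AB [x0 Ax0]; apply: contrapT => /forall2NP small.
have B0 : (0 < ncard B)%N.
  by apply: ncard_gt0 => //; exists (f x0); exact: AB.
have : (ncard B * ncard A <= ncard B * (ncard A).-1)%N.
  rewrite {1}(ncard_fibers finA finB AB) big_distrr /=.
  rewrite -[X in (_ <= X)%N]mulnC -[X in (_ <= _ * X)%N]count_predT.
  rewrite -iter_addn_0 -big_const_seq !big_seq leq_sum// => b.
  rewrite in_fset_set// inE => Bb; case: (small b) => // /negP.
  by rewrite -ltnNge => lt; rewrite -ltnS (ltn_predK lt).
have A0 : (0 < ncard A)%N by apply: ncard_gt0 => //; exists x0.
by rewrite leq_pmul2l// -ltnS prednK// ltnn.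
Qed.

Lemma ncard_subset (T : choiceType) (A B : set T) : finite_set B ->
  A `<=` B -> (ncard A <= ncard B)%N.
Proof. by move=> finB AB; apply: (ncard_inj (f := id)). Qed.

Lemma ncardU_le (T : choiceType) (A B : set T) : finite_set A ->
  finite_set B -> (ncard (A `|` B) <= ncard A + ncard B)%N.
Proof.
by move=> finA finB; rewrite /ncard fset_setU// cardfsU leq_subr.
Qed.

Lemma ncard_bigcup_le (T : choiceType) (n : nat) (A : set T)
    (C : nat -> set T) : (forall k, finite_set (C k)) ->
  (forall x, A x -> exists2 k, (k < n)%N & C k x) ->
  (ncard A <= \sum_(k < n) ncard (C k))%N.
Proof.
move=> finC; elim: n A => [|n IH] A AC.
  have -> : A = set0 by apply/seteqP; split=> // x /AC[].
  by rewrite /ncard fset_set0 cardfs0.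
have finI : finite_set (\bigcup_(k in `I_n) C k).
  by apply: bigcup_finite => // k _; exact: finC.
rewrite big_ord_recr /=.
apply: leq_trans (leq_trans (ncardU_le finI (finC n)) _).
  apply: ncard_subset; first by rewrite finite_setU; split.
  move=> x /AC[k]; rewrite ltnS leq_eqVlt => /predU1P[->|kn] Cx; first by right.
  by left; exists k.
by rewrite leq_add2r; apply: IH => x [k kn Cx]; exists k.
Qed.

Lemma ncard_sum_fibers (T : choiceType) (n : nat) (A : set T) (f : T -> nat) :
  finite_set A ->
  (\sum_(k < n) ncard (A `&` [set x | f x = k]) <= ncard A)%N.
Proof.
move=> finA; have finI k : finite_set (A `&` [set x | f x = k]).
  exact: finite_setIl.
suff -> : (\sum_(k < n) ncard (A `&` [set x | f x = k]))%N =
    ncard (A `&` [set x | (f x < n)%N]).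
  by apply: ncard_subset => // x [].
rewrite (@ncard_fibers _ _ _ `I_n f) //; [|exact: finite_setIl|by move=> x []].
rewrite -(big_mkord xpredT (fun k => ncard (A `&` [set x | f x = k]))).
rewrite (perm_big (enum_fset (fset_set `I_n))) /=; last first.
  apply: uniq_perm; rewrite ?iota_uniq ?fset_uniq// => k.
  rewrite mem_index_iota in_fset_set//.
  by apply/idP/idP => [?|/set_mem//]; exact/mem_set.
rewrite !big_seq; apply: eq_bigr => k; rewrite in_fset_set// => /set_mem kn.
congr ncard; apply/seteqP; split=> x /= [] // Ax fx.
  by do !split => //; rewrite fx.
by case: Ax.
Qed.

Lemma ncard_ord n : ncard `I_n = n.
Proof. exact: card_fset_set. Qed.

Lemma ncard_image_le (T U : choiceType) (f : T -> U) (A : set T) :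
  finite_set A -> (ncard (f @` A) <= ncard A)%N.
Proof.
by move=> finA; rewrite /ncard fset_set_image// (leq_trans (leq_imfset_card _ _ _)).
Qed.

(** * Exponential rates of growth *)

Section Growth.
Variable R : realType.
Implicit Types (s t : nat -> R) (u : nat -> nat) (q r b : R) (n k : nat).
Definition subexponential s := forall q, 1 < q -> \forall n \near \oo, s n <= q ^+ n.
Lemma subexponentialM s t : (forall n, 0 <= s n) -> (forall n, 0 <= t n) ->
  subexponential s -> subexponential t -> subexponential (fun n => s n * t n).
Proof.
move=> s0 t0 ss st q q1; have p1 : 1 < Num.sqrt q.
  by rewrite -[X in X < _]sqrtr1 ltr_sqrt// (lt_trans _ q1).
near=> n; rewrite -(sqr_sqrtr (a := q)) ?(ltW (lt_trans _ q1))//.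
rewrite -exprM mulnC exprM expr2 ler_pM//.
  by near: n; exact: ss.
by near: n; exact: st.
Unshelve. all: by end_near. Qed.

(** The square of Bernoulli's lower bound for [Num.sqrt q ^+ n] is quadratic in
    [n]. *)
Lemma subexponential_succ : subexponential (fun n => n.+1%:R).
Proof.
move=> q q1; pose t := Num.sqrt q - 1.
have t0 : 0 < t.
  by rewrite subr_gt0 -[X in X < _]sqrtr1 ltr_sqrt// (lt_trans _ q1).
have bernoulli n : 1 + n%:R * t <= (1 + t) ^+ n.
  elim: n => [|n IH]; first by rewrite mul0r addr0 expr0.
  rewrite exprS -natr1; have : 0 <= n%:R * t by rewrite mulr_ge0// ltW.
  nra.
near=> n.
have -> : q ^+ n = (1 + t) ^+ n * (1 + t) ^+ n.
  by rewrite addrC subrK -exprMn -expr2 sqr_sqrtr// (ltW (lt_trans _ q1)).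
have nt : 1 <= n%:R * t ^+ 2.
  rewrite -ler_pdivrMr ?exprn_gt0//; near: n.
  exact: nbhs_infty_ger.
apply: le_trans (ler_pM _ _ (bernoulli n) (bernoulli n)); last 2 first.
- by rewrite addr_ge0// mulr_ge0// ltW.
- by rewrite addr_ge0// mulr_ge0// ltW.
have : 0 <= n%:R * t by rewrite mulr_ge0// ltW.
have : (0 : R) <= n%:R by [].
rewrite -natr1; nra.
Unshelve. all: by end_near. Qed.

Lemma subexponential_cst r : subexponential (fun=> r).
Proof.
move=> q q1; near=> n; apply: (@le_trans _ _ n.+1%:R).
  by rewrite -natr1 ler_wpDr//; near: n; exact: nbhs_infty_ger.
by near: n; exact: subexponential_succ.
Unshelve. all: by end_near. Qed.

Lemma subexponential_absorb s r b : subexponential s -> 0 < r -> r < b ->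
  \forall n \near \oo, s n * r ^+ n <= b ^+ n.
Proof.
move=> ss r0 rb; near=> n.
rewrite -ler_pdivlMr ?exprn_gt0// -expr_div_n; near: n; apply: ss.
by rewrite ltr_pdivlMr// mul1r.
Unshelve. all: by end_near. Qed.

Lemma subexponential_shift s k : subexponential s ->
  subexponential (fun n => s (n + k)%N).
Proof.
move=> ss q q1; pose p := (1 + q) / 2.
have p1 : 1 < p by rewrite /p; lra.
have pq : p < q by rewrite /p; lra.
near=> n; apply: (@le_trans _ _ (p ^+ k * p ^+ n)); last first.
  near: n; apply: subexponential_absorb => //; last by rewrite (lt_trans _ p1).
  exact: subexponential_cst.
rewrite -exprD addnC; near: n.
have [N _ Ns] := ss p p1; exists N => // n /= Nn.
by rewrite addnC; apply: Ns => /=; rewrite (leq_trans Nn)// leq_addr.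
Unshelve. all: by end_near. Qed.

Definition growth_rate u b :=
  (forall r, b < r -> \forall n \near \oo, (u n)%:R <= r ^+ n) /\
  (forall r, 0 < r -> r < b -> \forall n \near \oo, r ^+ n <= (u n)%:R).

Lemma nrootX r n : (0 < n)%N -> 0 <= r -> (r ^+ n) `^ (n%:R^-1) = r.
Proof.
move=> n0 r0; rewrite -powR_mulrn// -powRrM mulfV ?powRr1//.
by rewrite pnatr_eq0 -lt0n.
Qed.

Lemma nroot_le k n r : (0 < n)%N -> 0 <= r -> k%:R <= r ^+ n ->
  nroot R k n <= r.
Proof.
move=> n0 r0 ur; rewrite -[leRHS](nrootX n0 r0).
by apply: ge0_ler_powR => //; rewrite ?nnegrE ?exprn_ge0.
Qed.

Lemma nroot_ge k n r : (0 < n)%N -> 0 <= r -> r ^+ n <= k%:R ->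
  r <= nroot R k n.
Proof.
move=> n0 r0 ur; rewrite -[leLHS](nrootX n0 r0).
by apply: ge0_ler_powR => //; rewrite ?nnegrE ?exprn_ge0.
Qed.

Lemma growth_rate_limn u b : 0 < b -> growth_rate u b ->
  limn (fun n => nroot R (u n) n) = b.
Proof.
move=> b0 [ub lb]; apply/cvg_lim => //; apply/cvgrPdist_le => e e0.
pose r := Num.max (b - e) (b / 2).
have r0 : 0 < r by rewrite lt_max; apply/orP; right; rewrite divr_gt0.
have rb : r < b by rewrite gt_max ltrBlDr ltrDl e0 /= ltr_pdivrMr//; lra.
near=> n; have n0 : (0 < n)%N by near: n; exact: nbhs_infty_gt.
rewrite distrC ler_distl; apply/andP; split.
  apply: (@le_trans _ _ r); first by rewrite le_max lexx.
  by apply: nroot_ge; rewrite ?(ltW r0)//; near: n; exact: lb.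
apply: nroot_le; rewrite ?(addr_ge0 (ltW b0) (ltW e0))//; near: n; apply: ub.
by rewrite ltrDl.
Unshelve. all: by end_near. Qed.

Lemma limn_esup_le (v : (\bar R)^nat) (x : \bar R) :
  (\forall n \near \oo, (v n <= x)%E) -> (limn_esup v <= x)%E.
Proof.
move=> vx; apply: ereal_inf_le;
  exists (ereal_sup [set v n | n in [set n | (v n <= x)%E]]).
  by exists [set n | (v n <= x)%E].
by apply: ge_ereal_sup => _ [n /= ? <-].
Qed.

Lemma le_limn_einf (v : (\bar R)^nat) (x : \bar R) :
  (\forall n \near \oo, (x <= v n)%E) -> (x <= limn_einf v)%E.
Proof.
move=> vx; rewrite /limn_einf leeNr; apply: limn_esup_le.
by apply: filterS vx => n; rewrite leeN2.
Qed.

Lemma le_limn_esup (v : (\bar R)^nat) (x : \bar R) :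
  (forall N, exists2 n, (N <= n)%N & (x <= v n)%E) -> (x <= limn_esup v)%E.
Proof.
move=> vx; apply: le_ereal_inf_tmp => _ [V [N _ NV] <-].
have [n Nn xv] := vx N; apply: le_ereal_sup_tmp; exists (v n) => //.
by exists n => //; exact: NV.
Qed.

(** Fekete's argument, with a loss of [c] in the index: the rate is the supremum
    of the [r] with [r ^+ (n + c) <= u n] for some [n]. As [0 < c], the
    exponents are positive, which makes the set of these [r] bounded. *)
Lemma supermultiplicative_rate u c (D : R) : (0 < c)%N -> 1 <= D ->
  (forall n, (0 < u n)%N) -> (forall n, (u n <= u n.+1)%N) ->
  (forall n, (u n)%:R <= D ^+ n) ->
  (forall m n, (u m * u n <= u (m + n + c))%N) ->
  exists b, [/\ 1 <= b, growth_rate u b &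
    forall r, b < r -> forall n, (u n)%:R <= r ^+ (n + c)].
Proof.
move=> c0 D1 u0 umono uD usup.
have monou : {homo u : m n / (m <= n)%N} by apply: homo_leq => //;
  exact: leq_trans.
pose E := [set r : R | 1 <= r /\ exists n, r ^+ (n + c) <= (u n)%:R].
have E1 : E 1 by split=> //; exists 0%N; rewrite expr1n ler1n.
have ED r : E r -> r <= D.
  move=> [r1 [n rn]]; rewrite -(@ler_pXn2r _ (n + c)) ?nnegrE ?addn_gt0 ?c0 ?orbT//.
  - apply: (le_trans rn); apply: (le_trans (uD n)).
    by rewrite ler_weXn2l// leq_addr.
  - exact: le_trans r1.
  - exact: le_trans D1.
have supE : has_sup E by split; [exists 1|exists D => r /ED].
exists (sup E); have b1 : 1 <= sup E by exact: ub_le_sup supE.2 _ E1.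
have upper r : sup E < r -> forall n, (u n)%:R <= r ^+ (n + c).
  move=> br n; rewrite leNgt; apply/negP => rn.
  have : r <= sup E; last by rewrite leNgt br.
  apply: ub_le_sup supE.2 _ _; split; last by exists n; exact: ltW.
  exact: le_trans b1 (ltW br).
split=> //; split=> [r br|r r0 rb].
  pose q := (sup E + r) / 2.
  have bq : sup E < q by rewrite /q; lra.
  have qr : q < r by rewrite /q; lra.
  near=> n; apply: le_trans (upper q bq n) _; rewrite exprD mulrC; near: n.
  apply: subexponential_absorb => //; first exact: subexponential_cst.
  by apply: lt_le_trans ltr01 _; exact: le_trans b1 (ltW bq).
have [q [q1 [n qn]] rq] := sup_gt supE.1 rb.
have blocks k : (q ^+ (n + c)) ^+ k <= (u (k * (n + c))%N)%:R.
  elim: k => [|k IH]; first by rewrite expr0 ler1n.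
  have q0 : 0 <= q by exact: le_trans ler01 q1.
  have qu := ler_pM (exprn_ge0 _ q0) (exprn_ge0 _ (exprn_ge0 _ q0)) qn IH.
  rewrite exprS; apply: (le_trans qu); rewrite -natrM ler_nat.
  by apply: leq_trans (usup _ _) _; rewrite mulSn addnAC.
(* Rounding [m] down to a multiple of [n + c] costs the constant [q ^+ (n +
   c)]. *)
near=> m; rewrite -(@ler_pM2l _ (q ^+ (n + c))) ?exprn_gt0 ?(lt_le_trans ltr01)//.
apply: (@le_trans _ _ (q ^+ m)).
  near: m; apply: subexponential_absorb => //; exact: subexponential_cst.
apply: (@le_trans _ _ (q ^+ ((n + c) * (m %/ (n + c)).+1))).
  by rewrite ler_weXn2l// mulnC ltnW// ltn_ceil// addn_gt0 c0 orbT.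
rewrite exprM exprS ler_pM2l ?exprn_gt0 ?(lt_le_trans ltr01)//.
by apply: le_trans (blocks _) _; rewrite ler_nat monou// leq_trunc_div.
Unshelve. all: by end_near. Qed.

End Growth.

(** * Walks and automorphisms *)

Section Walks.
Variable G : graph.
Implicit Types (u v w x y z o : G) (p q s : seq G) (H : set (G -> G))
  (h : G -> int).

Lemma path_rev v p : path (@adj G) v p ->
  path (@adj G) (last v p) (rev (belast v p)) /\
  last (last v p) (rev (belast v p)) = v.
Proof.
move=> vp; split.
  by rewrite rev_path (eq_path (e' := @adj G))// => x y; rewrite adj_sym.
by case: p vp => //= x p _; rewrite rev_cons last_rcons.
Qed.

Lemma path_to_saw v p : path (@adj G) v p ->
  exists q, [/\ path (@adj G) v q, last v q = last v p, uniq (v :: q) &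
    {subset q <= p}].
Proof.
by move=> /shortenP[q vq uq qp]; exists q; split=> // x /(mem_subseq qp).
Qed.

Definition upper h v := xget v [set w | adj v w /\ h v < h w].

Definition climb h v n := traject (upper h) (upper h v) n.

Definition ascendable h := forall v, exists w, adj v w /\ h v < h w.

Lemma upperP h v : ascendable h -> adj v (upper h v) /\ h v < h (upper h v).
Proof. by move=> /(_ v)[w ?]; rewrite /upper; case: xgetP => // /(_ w). Qed.

Lemma size_climb h v n : size (climb h v n) = n.
Proof. exact: size_traject. Qed.

Lemma climb_path h v n : ascendable h -> path (@adj G) v (climb h v n).
Proof.
move=> hup; apply: sub_path (fpath_traject (upper h) v n) => x y /eqP <-.
by have [] := upperP x hup.
Qed.

Lemma climb_height h v n : ascendable h ->
  h v + n%:Z <= h (last v (climb h v n)) /\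
  forall x, x \in climb h v n -> h v < h x /\ h x <= h (last v (climb h v n)).
Proof.
move=> hup; rewrite /climb; elim: n v => [|n IH] v /=.
  by split=> //; rewrite addr0.
have [_ vu] := upperP v hup; have [L B] := IH (upper h v).
split; first lia.
by move=> x; rewrite inE => /predU1P[->|/B]; lia.
Qed.

Lemma climb_uniq h v n : ascendable h -> uniq (v :: climb h v n).
Proof.
move=> hup; elim: n v => [//|n IH] v.
rewrite (_ : climb h v n.+1 = upper h v :: climb h (upper h v) n)//.
rewrite cons_uniq IH andbT; apply/negP => vin.
have [_ /(_ v vin)] := climb_height v n.+1 hup; lia.
Qed.

End Walks.

(** Unlike a graph height function, this is symmetric under [h] and [- h] and
    refers to no root. *)
Record height_structure (G : graph) (H : set (G -> G)) (h : G -> int) : Prop :=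
  HeightStructure {
    hs_conn : connected_graph G;
    hs_fin : locally_finite G;
    hs_aut : aut_subgroup H;
    hs_orbits : quasi_transitively_acting H;
    hs_diff : forall f u v, H f -> h (f v) - h (f u) = h v - h u;
    hs_up : ascendable h;
    hs_down : ascendable (fun v => - h v) }.

Lemma height_structureN (G : graph) (H : set (G -> G)) (h : G -> int) :
  height_structure H h -> height_structure H (fun v => - h v).
Proof.
move=> [c l a q d u w]; split=> // [f x y Hf|v].
  by have := d f x y Hf; lia.
by have [x [vx hx]] := u v; exists x; split=> //; lia.
Qed.

Section Automorphisms.
Variables (G : graph) (H : set (G -> G)).
Hypothesis aH : aut_subgroup H.
Implicit Types (u v w x y z o : G) (p q s : seq G) (h : G -> int) (f : G -> G).

Lemma aut_id : H id. Proof. by have [] := aH. Qed.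

Lemma aut_comp f g : H f -> H g -> H (f \o g).
Proof. by have [_ _ c _] := aH; exact: c. Qed.

Lemma aut_inv f : H f -> exists g, [/\ H g, cancel f g & cancel g f].
Proof. by have [_ _ _ i] := aH; exact: i. Qed.

Lemma aut_iter f n : H f -> H (iter n f).
Proof.
by move=> Hf; elim: n => [|n IH]; [exact: aut_id|exact: (aut_comp Hf IH)].
Qed.

Lemma aut_inj f : H f -> injective f.
Proof. by move=> /aut_inv[g [_ fK _]]; exact: can_inj fK. Qed.

Lemma aut_path f v p : H f -> path (@adj G) (f v) (map f p) = path (@adj G) v p.
Proof.
have [aut _ _ _] := aH; move=> /aut[_ fadj].
by rewrite path_map; apply: eq_path => x y /=; rewrite fadj.
Qed.

Lemma orbit_representatives (o : G) : quasi_transitively_acting H ->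
  exists r : seq G, forall v, exists2 u, u \in r & exists2 f, H f & f u = v.
Proof.
move=> fin; have /finite_seqP[r rE] : finite_set [set xget o A | A in range (Defs.orbit H)].
  exact: finite_image.
exists r => v; have : Defs.orbit H v (xget o (Defs.orbit H v)).
  by apply: xgetI; exists id => //; exact: aut_id.
move=> [f Hf fv]; have [g [Hg fK gK]] := aut_inv Hf.
exists (f v); last by exists g.
have : [set` r] (f v) by rewrite -rE; exists (Defs.orbit H v) => //; exists v.
by [].
Qed.

Lemma orbit_uniform (P : G -> nat -> Prop) : quasi_transitively_acting H ->
  (forall v, exists k, P v k) ->
  (forall v k k', P v k -> (k <= k')%N -> P v k') ->
  (forall f v k, H f -> P v k -> P (f v) k) ->
  exists k, forall v, P v k.
Proof.
move=> fin Pex Pmono PH; have [[w _]|none] := pselect (exists v : G, True);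
  last first.
  by exists 0%N => v; case: none; exists v.
have [r rP] := orbit_representatives w fin.
have [k kP] : exists k, forall u, u \in r -> P u k.
  elim: r {rP} => [|u r [k kP]]; first by exists 0%N.
  have [k' k'P] := Pex u; exists (maxn k k') => v.
  rewrite inE => /predU1P[->|/kP vk]; first by apply: Pmono k'P _;
    exact: leq_maxr.
  by apply: Pmono vk _; exact: leq_maxl.
by exists k => v; have [u ur [f Hf <-]] := rP v; apply: PH => //; exact: kP.
Qed.

End Automorphisms.

(** * Connections with controlled heights *)

Section Connections.
Variables (G : graph) (H : set (G -> G)) (h : G -> int).
Hypothesis hs : height_structure H h.
Implicit Types (u v w x y z o : G) (p q s : seq G) (f : G -> G).

Let aH := hs_aut hs.

Lemma heights_bounded v p :
  exists k : nat, forall z, z \in p -> h v - k%:Z <= h z /\ h z <= h v + k%:Z.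
Proof.
elim: p => [|x p [k kP]]; first by exists 0%N.
exists (k + `|h x - h v|)%N => z; rewrite inE => /predU1P[->|/kP]; lia.
Qed.

(** There are finitely many orbits and [H] preserves height differences, so one
    bound [k] on the height excursions serves all starting points. *)
Lemma connect_within (R : G -> G -> Prop) :
  (forall x, exists y, R x y) ->
  (forall f x y, H f -> R x y -> R (f x) (f y)) ->
  exists k : nat, forall x, exists p,
    [/\ path (@adj G) x p, R x (last x p) &
        forall z, z \in p -> h x - k%:Z <= h z /\ h z <= h x + k%:Z].
Proof.
move=> Rex RH; apply: (orbit_uniform aH (hs_orbits hs)) => [x|x k k' [p [xp Rp pk]] kk'|].
- have [y Rxy] := Rex x; have [p [xp py]] := hs_conn hs x y.
  by have [k kP] := heights_bounded x p; exists k, p; rewrite py.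
- by exists p; split=> // z /pk; lia.
move=> f x k Hf [p [xp Rp pk]]; exists (map f p).
rewrite last_map (aut_path aH)//; split=> //; first exact: RH.
by move=> _ /mapP[z zp ->]; have := hs_diff hs x z Hf; have := pk z zp; lia.
Qed.

(** The walk first climbs, then moves to some [g y] nearby, and finally follows
    a walk to a still higher point of the orbit that it never exceeds: seen from
    that point, this last walk descends far and then moves to the orbit. *)
Lemma bridge_to_orbit y : exists c : nat, forall x, exists p,
  [/\ bridges h x (size p) p, (size p <= c)%N & Defs.orbit H y (last x p)].
Proof.
have [k near] : exists k : nat, forall x, exists p,
    [/\ path (@adj G) x p, Defs.orbit H y (last x p) &
        forall z, z \in p -> h x - k%:Z <= h z /\ h z <= h x + k%:Z].
  apply: (connect_within (R := fun _ => Defs.orbit H y)) => [_|g _ _ Hg [f Hf <-]].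
    by exists y; exists id => //; exact: aut_id.
  by exists (g \o f) => //; exact: aut_comp.
apply: (orbit_uniform aH (hs_orbits hs)); last first.
- move=> f x c Hf [p [[[_ xp up] ph] pc [g Hg gy]]]; exists (map f p).
  rewrite size_map last_map -gy; split=> //; last by exists (f \o g) => //;
    exact: aut_comp.
  split.
    split; rewrite ?size_map ?(aut_path aH)//.
    by rewrite -map_cons map_inj_uniq//; exact: aut_inj Hf.
  move=> _ /mapP[z zp ->]; rewrite last_map.
  have := hs_diff hs x z Hf; have := hs_diff hs z (last x p) Hf.
  by have := ph z zp; lia.
- by move=> x c c' [p [bp pc py]] cc'; exists p; split=> //;
    exact: leq_trans cc'.
(* The connection [q2] loses at most [k] in height, and the final walk [t] goes
   at most [2 * k] below its own start: climbing [3 * k + 1] keeps all of it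
   above [x]. Descending by as much from [y] makes the end of [t] the highest
   point. *)
move=> x; pose q1 := climb h x (3 * k).+1; pose x' := last x q1.
have [q1n q1h] := climb_height x (3 * k).+1 (hs_up hs).
have [q2 [q2p [g Hg gE] q2h]] := near x'.
have [g' [Hg' gK g'K]] := aut_inv aH Hg.
pose s1 := climb (fun v => - h v) y (3 * k).+1; pose w := last y s1.
have [s1n s1h] := climb_height y (3 * k).+1 (hs_down hs).
have [s2 [s2p [f Hf fE] s2h]] := near w.
have [f' [Hf' fK f'K]] := aut_inv aH Hf.
have [] := @path_rev _ y (s1 ++ s2).
  by rewrite cat_path s2p andbT; exact: climb_path (hs_down hs).
rewrite last_cat -/w -fE => tp tl; set t := rev _ in tp tl.
have tsub z : z \in t -> h w - k%:Z <= h z /\ h z <= h y.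
  rewrite mem_rev => /mem_belast;
    rewrite inE mem_cat => /predU1P[->|/orP[/s1h|/s2h]].
  - by split=> //; move: s1n; rewrite -/s1 -/w; lia.
  - by rewrite -/s1 -/w; lia.
  - by move: s1n; rewrite -/s1 -/w; lia.
pose a := g \o f'; have Ha : H a by exact: aut_comp.
have [] := @path_to_saw _ x (q1 ++ q2 ++ map a t).
  rewrite !cat_path (climb_path _ _ (hs_up hs)) q2p andTb andTb.
  have -> : last x' q2 = a (f y) by rewrite -gE /a /= fK.
  by rewrite (aut_path aH).
have lastE : last x (q1 ++ q2 ++ map a t) = a y.
  rewrite !last_cat; have -> : last (last x q1) q2 = a (f y).
    by rewrite -gE /a /= fK.
  by rewrite last_map tl.
move=> p [xp pl pu psub]; exists (size p), p; split=> //; last first.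
  by rewrite pl lastE; exists a.
have gy : h (g y) <= h x' + k%:Z /\ h x' - k%:Z <= h (g y).
  rewrite gE; case: (q2) q2h => [|z q] q2h; first by rewrite /=; lia.
  by have := q2h _ (mem_last z q); rewrite /=; lia.
have wy : h (f y) <= h w + k%:Z /\ h w - k%:Z <= h (f y).
  rewrite fE; case: (s2) s2h => [|z q] s2h; first by rewrite /=; lia.
  by have := s2h _ (mem_last z q); rewrite /=; lia.
have ay : h (a y) - h (g y) = h y - h (f y).
  by rewrite -[in X in _ - h X](fK y); exact: (hs_diff hs (f y) y Ha).
split=> // z /psub; rewrite pl lastE !mem_cat => /or3P[/q1h|/q2h|/mapP[{}z zt ->]].
- by move: q1n s1n; rewrite -/x' -/w; lia.
- by move: q1n s1n; rewrite -/x' -/w; lia.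
have az := hs_diff hs z y Ha; have := tsub z zt.
by move: q1n s1n; rewrite -/x' -/w; lia.
Qed.

(** Climbing far from both points in parallel leaves room for a connection above
    them: as [sg] commutes with [H], the height excursions needed to go from [w]
    to [sg w] are bounded uniformly in [w]. *)
Lemma over_path o sg : H sg -> (forall v, h (sg v) = h v) ->
  (forall f, H f -> f \o sg = sg \o f) ->
  exists p, [/\ path (@adj G) o (rcons p (sg o)), uniq p &
    forall z, z \in p -> h o < h z].
Proof.
move=> Hs hsE sC.
have [k near] : exists k : nat, forall x, exists p,
    [/\ path (@adj G) x p, last x p = sg x &
        forall z, z \in p -> h x - k%:Z <= h z /\ h z <= h x + k%:Z].
  have [] := connect_within (R := fun x y => y = sg x); first by move=> x;
    exists (sg x).
    by move=> f x y /sC /(congr1 (@^~ x)) /= fs ->.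
  by move=> k kP; exists k.
pose u := upper h o; have [ou uo] := upperP o (hs_up hs).
pose q := climb h u k; pose w := last u q.
have [qn qh] := climb_height u k (hs_up hs).
(* The middle part [t] starts at height at least [h u + k]. *)
have [t [tp tl th]] := near w.
have qp : path (@adj G) u q by exact: climb_path (hs_up hs).
have [] := @path_rev _ (sg u) (map sg q); first by rewrite (aut_path aH).
rewrite last_map => rp rl.
have [] := @path_to_saw _ u (q ++ t ++ rev (belast (sg u) (map sg q))).
  by rewrite !cat_path qp tp tl.
rewrite !last_cat -/w tl rl => p [pp pl pu psub]; exists (u :: p); split=> //.
  rewrite rcons_path /= pl ou pp /=; have [aut _ _ _] := aH.
  by have [_ ->] := aut sg Hs; rewrite adj_sym.
move=> z; rewrite inE => /predU1P[->//|/psub];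
  rewrite !mem_cat => /or3P[/qh|/th|].
- by move: uo; rewrite -/u; lia.
- by move: uo qn; rewrite -/u -/w; lia.
rewrite mem_rev => /mem_belast; rewrite -map_cons => /mapP[{}z + ->].
rewrite inE hsE => /predU1P[->//|/qh]; move: uo; rewrite -/u; lia.
Qed.

End Connections.

(** * Finiteness of walks and balls *)

Section Finiteness.
Variable G : graph.
Hypotheses (Gconn : connected_graph G) (Glf : locally_finite G).
Implicit Types (u v w x y z o : G) (p q : seq G) (h : G -> int) (n : nat).

Definition walks v n : set (seq G) :=
  [set p | size p = n /\ path (@adj G) v p].

Lemma walks0 v : walks v 0 = [set [::]].
Proof. by apply/seteqP; split=> [p [/size0nil]|p ->]. Qed.

Lemma finite_walks v n : finite_set (walks v n).
Proof.
elim: n v => [|n IH] v; first by rewrite walks0; exact: finite_set1.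
apply: (@sub_finite_set _ _
  (\bigcup_(u in [set u | adj v u]) (cons u @` walks u n))).
  case=> [[]//|u p [/= [pn] /andP[vu up]]].
  by exists u => //; exists p.
by apply: bigcup_finite => // u _; exact: finite_image.
Qed.

Lemma finite_saws v n : finite_set (saws v n).
Proof. by apply: sub_finite_set (finite_walks v n) => p []. Qed.

Lemma finite_bridges h v n : finite_set (bridges h v n).
Proof. by apply: sub_finite_set (finite_saws v n) => p []. Qed.

Lemma graph_dist_path o v : exists p,
  [/\ path (@adj G) o p, last o p = v & size p = graph_dist o v].
Proof.
pose P n := `[< exists p, [/\ path (@adj G) o p, last o p = v & size p = n] >].
have exP : exists n, P n.
  have [p [op pv]] := Gconn o v; exists (size p); apply/asboolP.
  by exists p.
have [n /asboolP Pn nmin] := ex_minnP exP.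
rewrite /graph_dist; case: xgetP => [m _ []//|/(_ n) []].
split=> // p op pv; apply: nmin; apply/asboolP; by exists p.
Qed.

Lemma graph_dist_le o p :
  path (@adj G) o p -> (graph_dist o (last o p) <= size p)%N.
Proof.
move=> op; rewrite /graph_dist; case: xgetP => [m _ [_ /(_ p)]|//]; exact.
Qed.

Lemma finite_ball o n : finite_set [set v | (graph_dist o v <= n)%N].
Proof.
apply: (@sub_finite_set _ _ (\bigcup_(k in `I_n.+1) (last o @` walks o k))).
  move=> v /= vn; have [p [op pv pn]] := graph_dist_path o v.
  by exists (graph_dist o v) => //; exists p.
by apply: bigcup_finite => // k _; apply: finite_image; exact: finite_walks.
Qed.

Lemma ball_card_gt0 o n : (0 < ball_card o n)%N.
Proof.
apply: ncard_gt0; first exact: finite_ball.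
by exists o; apply: leq_trans (@graph_dist_le o [::] _) _.
Qed.

Lemma walks_exponential (R : realType) (H : set (G -> G)) : aut_subgroup H ->
  quasi_transitively_acting H ->
  exists2 D : R, 1 <= D & forall v n, (ncard (walks v n))%:R <= D ^+ n.
Proof.
move=> aH fin.
have [d dP] : exists d, forall v, (ncard [set u | adj v u] <= d)%N.
  apply: (orbit_uniform aH fin) => [v|v k k' vk kk'|f v k Hf vk].
  - by exists (ncard [set u | adj v u]).
  - exact: leq_trans vk kk'.
  - have [g [Hg fK gK]] := aut_inv aH Hf.
    apply: leq_trans vk; apply: (ncard_inj (f := g)) => // [u /= fu|u w _ _].
      by have [+ _ _ _] := aH => /(_ _ Hf)[_ fadj]; rewrite -fadj gK.
    by move/(congr1 f); rewrite !gK.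
exists (d.+1%:R) => [|v n]; first by rewrite ler1n.
elim: n v => [|n IH] v.
  by rewrite walks0 /ncard fset_set1 cardfs1 expr0.
rewrite exprS; apply: (@le_trans _ _ ((ncard [set u | adj v u])%:R * d.+1%:R ^+ n)).
  apply: (ncard_le_fibers (f := head v)) => //; first exact: finite_walks.
    by case=> [[]//|u p [_ /= /andP[]]].
  move=> u vu; apply: le_trans (IH u); rewrite ler_nat.
  apply: (ncard_inj (f := behead)); first exact: finite_walks.
    by case=> [[[[]]]|w p [[/= [pn] /andP[_ wp]] <-]].
  by move=> [|w p] [|w' p'] [[//= _ _ ->]] [[//= _ _ ->]] ->.
by rewrite ler_wpM2r ?exprn_ge0// ler_nat (leq_trans (dP v)).
Qed.

End Finiteness.

(** * Bridges *)

Section BridgeAlgebra.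
Variable G : graph.
Implicit Types (u v w x y z o : G) (p q : seq G) (h : G -> int) (n : nat).

Lemma bridge_cat h v m n p q : bridges h v m p ->
  bridges h (last v p) n q -> bridges h v (m + n) (p ++ q).
Proof.
move=> [[pm vp up] hp] [[qn lq uq] hq].
have vl : h v <= h (last v p).
  by case: (p) hp => //= x s /(_ _ (mem_last x s))/andP[/ltW].
have ll : h (last v p) <= h (last (last v p) q).
  by case: (q) hq => //= x s /(_ _ (mem_last x s))/andP[/ltW].
split; last first.
  move=> x; rewrite mem_cat last_cat => /orP[/hp|/hq] /andP[]; lia.
split; rewrite ?size_cat ?pm ?qn// ?cat_path ?vp ?lq//.
rewrite -cat_cons cat_uniq up; move: uq; rewrite cons_uniq => /andP[_ ->].
rewrite andbT; apply/hasPn => x /hq /andP[lx _]; apply/negP.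
rewrite /= inE => /predU1P[xv|/hp/andP[_]]; last lia.
by move: lx; rewrite xv; lia.
Qed.

Lemma bridge_climb h v n : ascendable h -> bridges h v n (climb h v n).
Proof.
move=> hup; have [_ B] := climb_height v n hup.
split; first by split; [exact: size_climb|exact: climb_path|exact: climb_uniq].
by move=> x /B[? ?]; apply/andP.
Qed.

Lemma bridge_map (H : set (G -> G)) h f v n p : height_structure H h -> H f ->
  bridges h v n p -> bridges h (f v) n (map f p).
Proof.
move=> hs Hf [[pn vp up] hp]; have aH := hs_aut hs; split.
  split; rewrite ?size_map ?(aut_path aH)//.
  by rewrite -map_cons map_inj_uniq//; exact: (aut_inj aH Hf).
move=> _ /mapP[z /hp zp ->]; rewrite last_map.
have := hs_diff hs v z Hf; have := hs_diff hs z (last v p) Hf; lia.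
Qed.

End BridgeAlgebra.

Section BridgeCounting.
Variables (G : graph) (H : set (G -> G)) (h : G -> int).
Hypothesis hs : height_structure H h.
Implicit Types (u v w x y z o : G) (p q : seq G) (f : G -> G) (m n : nat).

Let aH := hs_aut hs.
Let finb v n : finite_set (bridges h v n) := finite_bridges (hs_fin hs) h v n.

Lemma bridges_nonempty v n : (0 < ncard (bridges h v n))%N.
Proof.
by apply: ncard_gt0 => //; exists (climb h v n);
  exact: (bridge_climb _ _ (hs_up hs)).
Qed.

Lemma bridges_succ v n : (ncard (bridges h v n) <= ncard (bridges h v n.+1))%N.
Proof.
apply: (ncard_inj (f := fun p => p ++ climb h (last v p) 1)) => //.
  by move=> p bp; rewrite -addn1; apply: bridge_cat => //;
    exact: (bridge_climb _ _ (hs_up hs)).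
move=> p q [[pn _ _] _] [[qn _ _] _] /eqP.
by rewrite eqseq_cat ?pn// => /andP[/eqP].
Qed.

(** Bridges from [o] are joined at points of the orbit of [o] only, so that the
    second one is the image of a bridge from [o]; [c] pays for the way there. *)
Lemma bridges_supermultiplicative o : exists2 c, (0 < c)%N & forall m n,
  (ncard (bridges h o m) * ncard (bridges h o n) <=
   ncard (bridges h o (m + n + c)))%N.
Proof.
have [c ext] := bridge_to_orbit hs o; exists c.+1 => // m n.
(* The detour depends on the endpoint of [p] only, so [p] and then [q] can be
   read off the concatenation; the final climb equalizes the lengths. *)
have /choice[E EP] x : exists e : seq G * (G -> G), [/\ H e.2,
    bridges h x (size e.1) e.1, (size e.1 <= c)%N & e.2 o = last x e.1].
  by have [p [bp pc [f Hf fo]]] := ext x; exists (p, f).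
pose r p q := p ++ (E (last o p)).1 ++ map (E (last o p)).2 q.
apply: (ncardX_inj (f := fun pq : seq G * seq G =>
    let s := r pq.1 pq.2 in s ++ climb h (last o s) (m + n + c.+1 - size s))) => //.
  move=> p q bp bq /=; have [Hf be ec eE] := EP (last o p).
  have br : bridges h o (size (r p q)) (r p q).
    rewrite /r !size_cat; have [[-> _ _] _] := bp; apply: (bridge_cat bp).
    apply: (bridge_cat be); rewrite -eE size_map; have [[-> _ _] _] := bq.
    exact: (bridge_map hs Hf bq).
  have rn : (size (r p q) <= m + n + c.+1)%N.
    have [[pm _ _] _] := bp; have [[qn _ _] _] := bq.
    by rewrite /r !size_cat size_map pm qn; move: ec; lia.
  rewrite -[X in bridges _ _ X](subnKC rn).
  by apply: bridge_cat => //; exact: (bridge_climb _ _ (hs_up hs)).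
move=> p q p' q' [[pm _ _] _] [[qn _ _] _] [[pm' _ _] _] [[qn' _ _] _] /=.
rewrite /r -!catA => /eqP; rewrite eqseq_cat ?pm ?pm'// => /andP[/eqP pp].
have [Hf _ _ _] := EP (last o p); rewrite -pp eqseq_cat// => /andP[_].
rewrite eqseq_cat ?size_map ?qn ?qn'// => /andP[/eqP + _].
by move/(inj_map (aut_inj aH Hf)).
Qed.

(** A bridge of bounded length leads from [o] to some image [f v]; the images of
    the bridges from [v] continue it. *)
Lemma bridges_from_root o : exists c, forall v n,
  (ncard (bridges h v n) <= ncard (bridges h o (n + c)))%N.
Proof.
have [c cP] : exists c, forall v, exists2 p, bridges h o (size p) p &
    (size p <= c)%N /\ Defs.orbit H v (last o p).
  apply: (orbit_uniform aH (hs_orbits hs)).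
  - move=> v; have [c /(_ o)[p [bp pc vp]]] := bridge_to_orbit hs v.
    by exists c, p.
  - by move=> v c c' [p bp [pc vp]] cc'; exists p => //; split=> //;
      exact: leq_trans cc'.
  move=> f v c Hf [p bp [pc [g Hg gv]]]; exists p => //; split=> //.
  have [f' [Hf' fK _]] := aut_inv aH Hf.
  by exists (g \o f'); [exact: aut_comp|rewrite /= fK].
exists c => v n; have [p bp [pc [f Hf fv]]] := cP v.
pose r q := p ++ map f q.
have szr q : bridges h v n q -> size (r q) = (size p + n)%N.
  by move=> [[qn _ _] _]; rewrite /r size_cat size_map qn.
apply: (ncard_inj (f := fun q => r q ++ climb h (last o (r q)) (c - size p))) => //.
  move=> q bq; rewrite (_ : (n + c = size p + n + (c - size p))%N); last by lia.
  apply: bridge_cat; last by exact: (bridge_climb _ _ (hs_up hs)).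
  by apply: (bridge_cat bp); rewrite -fv; exact: (bridge_map hs Hf bq).
move=> q q' bq bq' /eqP; rewrite eqseq_cat ?(szr _ bq) ?(szr _ bq')//.
rewrite /r eqseq_cat// => /andP[/andP[_ /eqP]] + _.
by move/(inj_map (aut_inj aH Hf)).
Qed.

Definition periods o (a : G -> G) n : set (seq G) :=
  bridges h o n `&` [set p | last o p = a o].

(** Pigeonhole over lengths and over endpoints in a ball, after an extension
    into the orbit of [o]. At a common endpoint [a o], images of these bridges
    can be attached to one another. *)
Lemma many_periods o : exists c, forall n, exists a n', [/\ H a,
  (n <= n' <= n + c)%N & (ncard (bridges h o n) <=
    ball_card o (n + c) * c.+1 * ncard (periods o a n'))%N].
Proof.
have [c ext] := bridge_to_orbit hs o; exists c => n.
have /choice[E EP] x : exists p, [/\ bridges h x (size p) p,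
    (size p <= c)%N & Defs.orbit H o (last x p)] by exact: ext.
pose B := [set v | (graph_dist o v <= n + c)%N].
have finB : finite_set B := finite_ball (hs_conn hs) (hs_fin hs) o (n + c).
have Ecat p : bridges h o n p ->
    bridges h o (n + size (E (last o p))) (p ++ E (last o p)).
  by move=> bp; apply: bridge_cat => //; have [] := EP (last o p).
have [] := @ncard_pigeonhole _ _ (bridges h o n) (B `*` `I_c.+1)
    (fun p => (last o (p ++ E (last o p)), size (E (last o p)))) => //.
- exact: finite_setX.
- move=> p bp; have [_ ec _] := EP (last o p).
  split=> //=; have [[pn op _] _] := Ecat p bp.
  by apply: leq_trans (graph_dist_le op) _; rewrite pn leq_add2l.
- by exists (climb h o n); exact: (bridge_climb _ _ (hs_up hs)).
move=> [y k] [_ /= kc]; rewrite ncardX// ncard_ord.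
set F := (X in (_ <= _ * ncard X)%N) => cF.
have [p [bp [py pk]]] : F !=set0.
  apply/set0P; apply: contraTneq (leq_trans (bridges_nonempty o n) cF) => ->.
  by rewrite /ncard fset_set0 cardfs0 muln0.
have [_ _ [a Ha ao]] := EP (last o p); exists a, (n + k)%N; split=> //.
  by rewrite leq_addr leq_add2l.
apply: leq_trans cF _; rewrite leq_mul2l; apply/orP; right.
apply: (ncard_inj (f := fun q => q ++ E (last o q))).
- by apply: finite_setIl.
- move=> q [bq [qy qk]]; split; first by rewrite -qk; exact: Ecat.
  by rewrite /= qy -py last_cat.
move=> q q' [[[qn _ _] _] _] [[[qn' _ _] _] _] /eqP.
by rewrite eqseq_cat ?qn// => /andP[/eqP].
Qed.

End BridgeCounting.

(** * The bridge rate *)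

Section BridgeRate.
Variables (R : realType) (G : graph) (o : G) (H : set (G -> G)).
Implicit Types (u v w x y z : G) (p q : seq G) (f : G -> G) (m n : nat)
  (h : G -> int).

Lemma bridge_rate_exists h : height_structure H h -> exists b : R,
  [/\ 1 <= b, growth_rate (fun n => ncard (bridges h o n)) b &
    forall r, b < r -> exists2 C, 0 < C &
      forall v n, (ncard (bridges h v n))%:R <= C * r ^+ n].
Proof.
move=> hs; have [D D1 DP] := walks_exponential (hs_fin hs) R (hs_aut hs) (hs_orbits hs).
have [c c0 cP] := bridges_supermultiplicative hs o.
have [c' c'P] := bridges_from_root hs o.
have [] := @supermultiplicative_rate R (fun n => ncard (bridges h o n)) c D c0 D1.
- by move=> n; exact: bridges_nonempty hs o n.
- by move=> n; exact: bridges_succ hs o n.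
- move=> n; apply: le_trans (DP o n); rewrite ler_nat; apply: ncard_subset.
    exact: finite_walks (hs_fin hs) _ _.
  by move=> p [[]].
- exact: cP.
move=> b [b1 gb upper]; exists b; split=> // r br.
have r0 : 0 < r by rewrite (lt_trans _ br)// (lt_le_trans _ b1).
exists (r ^+ (c' + c)) => [|v n]; first by rewrite exprn_gt0.
rewrite -exprD addnC addnA; apply: le_trans (upper r br _).
by rewrite ler_nat.
Qed.

(** Reading a bridge from its end, after one step upwards that makes the
    starting height strictly extremal, gives a bridge for [- h]. *)
Lemma periods_reverse h a n : height_structure H h ->
  (ncard (periods h o a n) <=
   ncard (bridges (fun v => - h v) (upper h (a o)) n.+1))%N.
Proof.
move=> hs; apply: (ncard_inj (f := fun p => rev (o :: p))).
- exact: finite_bridges (hs_fin hs) _ _ _.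
- move=> p [[[pn vp up] hp] pa]; rewrite /= in pa.
  have [au ha] := upperP (a o) (hs_up hs).
  have ho x : x \in o :: p -> h o <= h x /\ h x <= h (a o).
    rewrite inE -pa => /predU1P[->|/hp/andP[]]; last lia.
    by case: (p) hp => //= x' s /(_ _ (mem_last x' s))/andP[/ltW].
  have [rp rl] := path_rev vp; rewrite pa in rp rl.
  split; last first.
    move=> x; rewrite mem_rev rev_cons last_rcons => /ho; lia.
  split; first by rewrite size_rev /= pn.
    by rewrite lastI rev_rcons /= pa adj_sym au.
  rewrite cons_uniq rev_uniq up andbT mem_rev; apply/negP => /ho; lia.
by move=> p q _ _ /(can_inj revK)[].
Qed.

Hypothesis sub : subexponential (fun n => (ball_card o n)%:R : R).

(** With [periods_reverse], the bridges for [h] that end at a most frequent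
    point are bounded by the bridges for [- h]. *)
Lemma bridge_rate_le h (b b' : R) : height_structure H h ->
  growth_rate (fun n => ncard (bridges h o n)) b -> 1 <= b' ->
  (forall r, b' < r -> exists2 C, 0 < C & forall v n,
    (ncard (bridges (fun v => - h v) v n))%:R <= C * r ^+ n) -> b <= b'.
Proof.
move=> hs [_ lb] b'1 ub; rewrite leNgt; apply/negP => bb.
pose r := b' + (b - b') / 3; pose q := b' + (b - b') / 2.
pose s := b' + 2 * (b - b') / 3.
have br : b' < r by rewrite /r; lra.
have rq : r < q by rewrite /r /q; lra.
have qs : q < s by rewrite /q /s; lra.
have sb : s < b by rewrite /s; lra.
have r1 : 1 <= r by lra.
have [C C0 CP] := ub r br.
have [c cP] := many_periods hs o.
have /filter_ex[n [sn nq n0]] : \forall n \near \oo, [/\ s ^+ n <= (ncard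
    (bridges h o n))%:R,
    (ball_card o (n + c))%:R * (c.+1%:R * (C * r ^+ c.+1)) * r ^+ n <= q ^+ n &
    (0 < n)%N].
  near=> n; split.
  - by near: n; apply: lb => //; lra.
  - near: n; apply: (subexponential_absorb (s := fun n =>
        (ball_card o (n + c))%:R * (c.+1%:R * (C * r ^+ c.+1)))) => //;
          last lra.
    apply: subexponentialM => //.
    + by move=> _; rewrite !mulr_ge0// ?exprn_ge0 ?ltW//; lra.
    + exact: (subexponential_shift c sub).
    + exact: subexponential_cst.
  - by near: n; exact: nbhs_infty_gt.
have [a [n' [Ha /andP[_ n'n] bn]]] := cP n.
have : s ^+ n <= q ^+ n.
  apply: le_trans nq; apply: (le_trans sn).
  rewrite -(ler_nat R) in bn; apply: (le_trans bn).
  rewrite natrM natrM -!mulrA; do 2 rewrite ler_wpM2l//.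
  have := periods_reverse a n' hs; rewrite -(ler_nat R) => /le_trans -> //.
  apply: (le_trans (CP _ _)); rewrite ler_wpM2l ?(ltW C0)// -exprD.
  by rewrite ler_weXn2l// addSn addnC ltnS.
have q0 : 0 <= q by lra.
have s0 : 0 <= s by lra.
by rewrite ler_pXn2r ?nnegrE// leNgt qs.
Unshelve. all: by end_near. Qed.

End BridgeRate.

(** * Walks are not much more numerous than bridges *)

Section HammersleyWelsh.
Variables (R : realType) (G : graph) (H : set (G -> G)) (h : G -> int).
Hypothesis hs : height_structure H h.
Implicit Types (u v w x y z o : G) (p q : seq G) (f : G -> G) (m n k a : nat)
  (b : bool).

Let aH := hs_aut hs.

Definition signed b v := if b then - h v else h v.

Lemma signedN b v : signed (~~ b) v = - signed b v.
Proof. by case: b => //=; rewrite opprK. Qed.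

Lemma signed_structure b : height_structure H (signed b).
Proof. by case: b => //; exact: height_structureN. Qed.

Definition half_space_walks b v n : set (seq G) :=
  saws v n `&` [set p : seq G | forall x, x \in p -> signed b v < signed b x].

Definition narrow_walks b v n a : set (seq G) :=
  half_space_walks b v n `&`
  [set p : seq G | forall x, x \in p -> signed b x <= signed b v + a%:Z].

Definition span_bridges b v n a : set (seq G) :=
  bridges (signed b) v n `&`
  [set p | signed b (last v p) = signed b v + a.+1%:Z].

Let finh b v n : finite_set (half_space_walks b v n).
Proof. by apply: finite_setIl; exact: finite_saws (hs_fin hs) _ _. Qed.

Let finn b v n a : finite_set (narrow_walks b v n a).
Proof. exact: finite_setIl. Qed.

Let fins b v n a : finite_set (span_bridges b v n a).
Proof. by apply: finite_setIl; exact: finite_bridges (hs_fin hs) _ _ _. Qed.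

Lemma last_occurrence (P : pred G) p : has P p -> exists p1 x p2,
  [/\ p = rcons p1 x ++ p2, P x & forall z, z \in p2 -> ~~ P z].
Proof.
elim: p => //= y p IH; have [/IH[p1 [x [p2 [-> Px p2P]]]] _|] := boolP (has P p).
  by exists (y :: p1), x, p2.
by rewrite orbF => /hasPn none Py; exists [::], y, p.
Qed.

(** A half-space walk that attains its largest span [a.+1] is a bridge up to the
    last point of maximal height, followed by a half-space walk for the opposite
    height of span at most [a]. *)
Lemma narrow_walks_succ (M : nat -> R) b v n a :
  (forall k w, (k <= n)%N -> (ncard (narrow_walks (~~ b) w (n - k) a))%:R <= M k) ->
  (ncard (narrow_walks b v n a.+1))%:R <= (ncard (narrow_walks b v n a))%:R +
    \sum_(k < n.+1) (ncard (span_bridges b v k a))%:R * M k.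
Proof.
move=> MP.
pose C k := narrow_walks b v n a.+1 `&` [set p | [/\ (k <= n)%N,
  span_bridges b v k a (take k p) &
  narrow_walks (~~ b) (last v (take k p)) (n - k) a (drop k p)]].
have finC k : finite_set (C k) by exact: finite_setIl.
pose D := narrow_walks b v n a.+1 `\` narrow_walks b v n a.
have split_le : (ncard (narrow_walks b v n a.+1) <=
    ncard (narrow_walks b v n a) + \sum_(k < n.+1) ncard (C k))%N.
  have finD : finite_set D by exact: finite_setD.
  apply: leq_trans (leq_trans (ncardU_le (finn b v n a) finD) _).
    apply: ncard_subset; first by rewrite finite_setU; split.
    by move=> p np; have [?|?] := pselect (narrow_walks b v n a p);
      [left|right].
  rewrite leq_add2l; apply: ncard_bigcup_le => // p [np nnp].
  have [[[pn vp up] hp] pa] := np.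
  have : has (fun x => signed b x == signed b v + a.+1%:Z) p.
    apply: contrapT => /negP/hasPn none; apply: nnp; split; first by split.
    by move=> x xp; have := none x xp; have := pa x xp; lia.
  move=> /last_occurrence[p1 [x [p2 [pE /eqP xa p2a]]]].
  have tk : take (size p1).+1 p = rcons p1 x.
    by rewrite pE take_size_cat// size_rcons.
  have dk : drop (size p1).+1 p = p2.
    by rewrite pE drop_size_cat// size_rcons.
  have szp : ((size p1).+1 + size p2 = n)%N by rewrite -pn pE size_cat size_rcons.
  have /andP[vp1 xp2] : path (@adj G) v (rcons p1 x) && path (@adj G) x p2.
    by move: vp; rewrite pE cat_path last_rcons.
  have /and3P[up1 /hasPn np12 up2] : [&& uniq (v :: rcons p1 x),
      ~~ has (mem (v :: rcons p1 x)) p2 & uniq p2].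
    by move: up; rewrite pE -cat_cons cat_uniq.
  have kn : ((size p1).+1 <= n)%N by rewrite -szp; exact: leq_addr.
  exists (size p1).+1 => //; split=> //; split=> //.
    rewrite tk; split; last by rewrite /= last_rcons.
    split; first by rewrite /saws /= size_rcons.
    move=> z zp1; rewrite last_rcons xa.
    have zp : z \in p by rewrite pE mem_cat zp1.
    by rewrite hp// pa.
  rewrite tk dk last_rcons; split; last first.
    move=> z zp2; rewrite !signedN xa.
    have zp : z \in p by rewrite pE mem_cat zp2 orbT.
    by have := hp z zp; lia.
  split.
    split=> //; first by rewrite -szp addKn.
    rewrite cons_uniq up2 andbT; apply/negP => /np12.
    by rewrite /= inE mem_rcons inE eqxx orbT.
  move=> z zp2; rewrite !signedN ltrN2 xa.
  have zp : z \in p by rewrite pE mem_cat zp2 orbT.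
  by have := pa z zp; have := p2a z zp2; lia.
rewrite -(ler_nat R) in split_le; apply: (le_trans split_le).
rewrite natrD lerD2l natr_sum ler_sum// => k _.
apply: (ncard_le_fibers (f := take k)) => // [p [_ []]//|p bp].
have kn : (k <= n)%N by rewrite -ltnS.
apply: le_trans (MP k (last v p) kn); rewrite ler_nat.
apply: (ncard_inj (f := drop k)) => // [q [[_ [_ _ nq]] /= <-]//|].
by move=> q q' [_ /= qp] [_ /= q'p] dq;
  rewrite -(cat_take_drop k q) qp -q'p dq cat_take_drop.
Qed.

Lemma span_bridges_orbit f b v n a : H f ->
  (ncard (span_bridges b (f v) n a) <= ncard (span_bridges b v n a))%N.
Proof.
move=> Hf; have [g [Hg fK gK]] := aut_inv aH Hf.
have sb := signed_structure b.
apply: (ncard_inj (f := map g)) => // [p [bp /= pa]|p q _ _]; last first.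
  exact: inj_map (aut_inj aH Hg) _ _.
split; first by have := bridge_map sb Hg bp; rewrite fK.
rewrite /= -[X in last X](fK v) last_map.
have := hs_diff sb (f v) (last (f v) p) Hg; rewrite fK; lia.
Qed.

Lemma span_bridges_sum b v n a :
  (\sum_(k < a) ncard (span_bridges b v n k) <= ncard (bridges (signed b) v n))%N.
Proof.
have finb := finite_bridges (hs_fin hs) (signed b) v n.
pose F (p : seq G) := `|signed b (last v p) - signed b v|.-1%N.
apply: leq_trans (ncard_sum_fibers a F finb).
apply: leq_sum => k _; apply: ncard_subset; first exact: finite_setIl.
by move=> p [bp /= pa]; split=> //; rewrite /F /= pa; lia.
Qed.

(** Over all spans, the numbers of bridges weighted by [q ^- k], with [k] their
    length, have a total of at most [S]. A half-space walk splits into bridges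
    of strictly decreasing spans, so the weight of such walks is at most the
    product of the [1 + B a], hence at most [expR S]. *)
Lemma half_space_walks_bound (o : G) (C r q : R) : 0 <= C -> 0 < r -> r < q -> 1 <= q ->
  (forall b v n, (ncard (bridges (signed b) v n))%:R <= C * r ^+ n) ->
  exists2 K, 0 <= K &
    forall b v n, (ncard (half_space_walks b v n))%:R <= K * q ^+ n.
Proof.
move=> C0 r0 rq q1 brC; have q0 : 0 < q by lra.
have [reps repsP] := orbit_representatives aH o (hs_orbits hs).
pose B N a := \sum_(u <- reps) \sum_(b : bool) \sum_(k < N.+1)
  (ncard (span_bridges b u k a))%:R / q ^+ k : R.
pose S := \sum_(u <- reps) \sum_(b : bool) C / (1 - r / q).
have rq1 : 0 < 1 - r / q by rewrite subr_gt0 ltr_pdivrMr// mul1r.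
have geometric N : \sum_(k < N) (r / q) ^+ k <= (1 - r / q)^-1.
  rewrite -[leRHS]mul1r ler_pdivlMr// mulrC.
  have -> : (1 - r / q) * \sum_(k < N) (r / q) ^+ k = 1 - (r / q) ^+ N.
    by rewrite -(opprB (r / q) 1) mulNr -subrX1 opprB.
  by rewrite gerBl exprn_ge0// divr_ge0// ltW.
have BS N a : \sum_(i < a) B N i <= S.
  rewrite exchange_big /=; apply: ler_sum => u _.
  rewrite exchange_big /=; apply: ler_sum => b _.
  rewrite exchange_big /=.
  apply: (@le_trans _ _ (\sum_(k < N.+1) C * (r / q) ^+ k)).
    apply: ler_sum => k _; rewrite -mulr_suml expr_div_n mulrA ler_pM2r
        ?invr_gt0 ?exprn_gt0//.
    by apply: le_trans (brC b u k); rewrite -natr_sum ler_nat span_bridges_sum.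
  by rewrite -mulr_sumr ler_wpM2l.
have Bge N b v a : \sum_(k < N.+1) (ncard (span_bridges b v k a))%:R / q ^+ k <= B N a.
  have [u ur [f Hf <-]] := repsP v.
  have term_ge0 b' u' (k : 'I_N.+1) : 0 <= (ncard (span_bridges b' u' k a))%:R / q ^+ k.
    by rewrite divr_ge0// exprn_ge0// ltW.
  rewrite /B (big_rem u)//= (bigD1 b)//= -addrA ler_wpDr//.
    by rewrite addr_ge0// sumr_ge0// => *; rewrite ?sumr_ge0// => *;
      rewrite sumr_ge0.
  apply: ler_sum => k _; rewrite ler_pM2r ?invr_gt0 ?exprn_gt0//.
  by rewrite ler_nat span_bridges_orbit.
(* [N] only truncates the sums over lengths: by [BS] the exponents here are at
   most [S] for all [N] and [a]. *)
have narrow N a b v n : (n <= N)%N ->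
    (ncard (narrow_walks b v n a))%:R <= expR (\sum_(i < a) B N i) * q ^+ n.
  elim: a b v n => [|a IH] b v n nN.
    rewrite big_ord0 expR0 mul1r (@le_trans _ _ 1) ?exprn_ege1//.
    rewrite (_ : 1 = 1%:R)// ler_nat -[leqRHS](cardfs1 ([::] : seq G)) -fset_set1.
    apply: ncard_subset => // -[//|x p [[_ /(_ x)] /= vx /(_ x)]].
    by rewrite mem_head in vx *; move=> /(_ isT); have := vx isT; lia.
  set E := expR (\sum_(i < a) B N i) in IH.
  have E0 : 0 <= E by exact: expR_ge0.
  apply: (le_trans (@narrow_walks_succ (fun k => E * q ^+ (n - k)) b v n a _)).
    by move=> k w kn; apply: IH; exact: leq_trans (leq_subr _ _) nN.
  apply: (@le_trans _ _ (E * q ^+ n * (1 + B N a))).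
    rewrite mulrDr mulr1 lerD ?IH//.
    apply: (@le_trans _ _ (E * q ^+ n *
        \sum_(k < n.+1) (ncard (span_bridges b v k a))%:R / q ^+ k)).
      rewrite mulr_sumr; apply: ler_sum => k _.
      rewrite expfB_cond; last by rewrite (gt_eqF q0) add0n -ltnS.
      by rewrite le_eqVlt; apply/orP; left; apply/eqP; ring.
    rewrite ler_wpM2l ?mulr_ge0 ?exprn_ge0 ?(ltW q0)//.
    apply: le_trans (Bge N b v a).
    rewrite -!(big_mkord xpredT (fun k => (ncard (span_bridges b v k a))%:R / q ^+ k)).
    rewrite [leRHS](@big_cat_nat _ _ _ n.+1)//= lerDl sumr_ge0// => k _.
    by rewrite divr_ge0// exprn_ge0// ltW.
  rewrite big_ord_recr /= expRD -/E mulrAC ler_wpM2r ?exprn_ge0 ?(ltW q0)//.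
  by rewrite ler_wpM2l// expR_ge1Dx.
exists (expR S); first exact: expR_ge0.
move=> b v n.
have /finite_seqP[s sE] : finite_set (half_space_walks b v n) by exact: finh.
have [a aP] := heights_bounded (signed b) v (flatten s).
have -> : half_space_walks b v n = narrow_walks b v n a.
  apply/seteqP; split=> p; last by case.
  move=> hp; split=> // x xp; apply: proj2 (aP x _); apply/flattenP;
    exists p => //.
  by have : [set` s] p by rewrite -sE.
apply: le_trans (narrow n a b v n (leqnn n)) _.
by rewrite ler_wpM2r ?exprn_ge0 ?(ltW q0)// ler_expR.
Qed.

End HammersleyWelsh.

Section WalkGrowth.
Variables (R : realType) (G : graph) (o : G) (H : set (G -> G)) (h : G -> int).
Hypothesis hs : height_structure H h.
Implicit Types (u v w x y z : G) (p q : seq G) (f : G -> G) (m n k : nat).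

Lemma last_minimum v p : exists p1 p2, [/\ p = p1 ++ p2,
  forall x, x \in v :: p1 -> h (last v p1) <= h x &
  forall x, x \in p2 -> h (last v p1) < h x].
Proof.
elim/last_ind: p => [|p y [p1 [p2 [-> min1 min2]]]].
  by exists [::], [::]; split=> // x; rewrite inE => /eqP ->.
have [yl|ly] := leP (h y) (h (last v p1)).
  exists (rcons (p1 ++ p2) y), [::]; rewrite cats0 last_rcons; split=> // x.
  rewrite inE mem_rcons inE mem_cat => /or4P[/eqP ->|/eqP -> //|xp|/min2];
    last lia.
    by have := min1 v (mem_head _ _); lia.
  by have := min1 x; rewrite inE xp orbT => /(_ isT); lia.
exists p1, (rcons p2 y); rewrite rcons_cat; split=> // x.
by rewrite mem_rcons inE => /predU1P[->//|/min2].
Qed.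

(** A self-avoiding walk is cut at its last point [z] of minimal height. The
    part after [z] is a half-space walk; the part before it, reversed and
    preceded by a step from below [z], is another one. The factor [ball_card o
    n] counts the possible points [z]. *)
Lemma saws_half_space (K r : R) n : 0 <= K -> 0 <= r ->
  (forall v k, (ncard (half_space_walks h false v k))%:R <= K * r ^+ k) ->
  (ncard (saws o n))%:R <=
    n.+1%:R * ((ball_card o n)%:R * (K * r ^+ n.+1 * K)).
Proof.
move=> K0 r0 hK; pose below := upper (fun v => - h v).
have finh v k : finite_set (half_space_walks h false v k).
  by apply: finite_setIl; exact: finite_saws (hs_fin hs) _ _.
pose C i := saws o n `&` [set p | [/\ (i <= n)%N,
  forall x, x \in o :: take i p -> h (last o (take i p)) <= h x &
  forall x, x \in drop i p -> h (last o (take i p)) < h x]].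
have finC i : finite_set (C i).
  by apply: finite_setIl; exact: finite_saws (hs_fin hs) _ _.
have : (ncard (saws o n) <= \sum_(i < n.+1) ncard (C i))%N.
  apply: ncard_bigcup_le => // p sp.
  have [p1 [p2 [pE min1 min2]]] := last_minimum o p.
  have p1n : (size p1 <= n)%N by have [<- _ _] := sp;
    rewrite pE size_cat leq_addr.
  exists (size p1) => //; split=> //.
  by rewrite /= pE take_size_cat// drop_size_cat.
rewrite -(ler_nat R) => /le_trans; apply; rewrite natr_sum.
rewrite -[X in _ <= X%:R * _](card_ord n.+1) mulr_natl -sumr_const.
apply: ler_sum => i _; have iN : (i <= n)%N by rewrite -ltnS.
apply: (ncard_le_fibers (f := fun p => last o (take i p))) => //.
- exact: finite_ball (hs_conn hs) (hs_fin hs) _ _.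
- move=> p [[pn op _] _] /=; apply: (@leq_trans (size (take i p)));
    first exact/graph_dist_le/take_path.
  by rewrite size_take pn; case: ltnP.
move=> z _; pose T := half_space_walks h false (below z) i.+1 `*`
  half_space_walks h false z (n - i).
apply: (@le_trans _ _ (ncard T)%:R).
  rewrite ler_nat.
  apply: (ncard_inj (f := fun p => (rev (o :: take i p), drop i p))).
  - exact: finite_setX.
  - move=> p [[[pn op up] [_ min1 min2]] /= pz]; rewrite pz in min1 min2.
    have [zb hb] := upperP z (hs_down hs).
    move: op up; rewrite -[X in path _ _ X](cat_take_drop i p) cat_path pz =>
        /andP[op1 zp2].
    rewrite -[X in _ :: X](cat_take_drop i p) -cat_cons cat_uniq.
    move=> /and3P[up1 /hasPn disj up2].
    have [rp _] := path_rev op1; rewrite pz in rp.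
    split; last first.
      split=> //=.
      split; rewrite ?size_drop ?pn// cons_uniq up2 andbT; apply/negP => /disj.
      by rewrite /= -pz mem_last.
    split; last first.
      move=> x /=; rewrite mem_rev => /min1; rewrite /below; lia.
    split.
    + by rewrite size_rev /= size_take pn; case: ltnP => //; lia.
    + by rewrite lastI rev_rcons /= pz rp andbT adj_sym.
    + rewrite cons_uniq rev_uniq up1 andbT mem_rev; apply/negP => /min1.
      rewrite /below; lia.
  move=> p p' _ _ [/(can_inj revK)[tp] dp].
  by rewrite -(cat_take_drop i p) tp dp cat_take_drop.
rewrite /T ncardX// natrM.
have -> : K * r ^+ n.+1 * K = K * r ^+ i.+1 * (K * r ^+ (n - i)).
  have -> : r ^+ n.+1 = r ^+ i.+1 * r ^+ (n - i).
    by rewrite -exprD addSn subnKC.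
  by ring.
by rewrite ler_pM.
Qed.

Hypothesis sub : subexponential (fun n => (ball_card o n)%:R : R).

Lemma saws_growth_le (b : R) : 1 <= b ->
  (forall s r, b < r -> exists2 C, 0 < C &
    forall v n, (ncard (bridges (signed h s) v n))%:R <= C * r ^+ n) ->
  forall r, b < r -> \forall n \near \oo, (ncard (saws o n))%:R <= r ^+ n.
Proof.
move=> b1 brC r br.
pose r1 := b + (r - b) / 3; pose r2 := b + (r - b) / 2.
have br1 : b < r1 by rewrite /r1; lra.
have r12 : r1 < r2 by rewrite /r1 /r2; lra.
have r2r : r2 < r by rewrite /r2; lra.
have r10 : 0 < r1 by lra.
have r20 : 0 < r2 by lra.
have [C C0 CP] : exists2 C, 0 <= C & forall s v n,
    (ncard (bridges (signed h s) v n))%:R <= C * r1 ^+ n.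
  have [C0 C00 C0P] := brC false r1 br1; have [C1 C10 C1P] := brC true r1 br1.
  exists (C0 + C1); first by rewrite addr_ge0// ltW.
  have rn n : 0 <= r1 ^+ n by rewrite exprn_ge0// ltW.
  case=> v n; rewrite mulrDl.
    by apply: le_trans (C1P v n) _; rewrite lerDr mulr_ge0// ltW.
  by apply: le_trans (C0P v n) _; rewrite lerDl mulr_ge0// ltW.
have [|K K0 KP] := @half_space_walks_bound R _ _ h hs o C r1 r2 C0 r10 r12 _ CP.
  by lra.
near=> n; apply: le_trans (saws_half_space n K0 (ltW r20) (KP false)) _.
have -> : n.+1%:R * ((ball_card o n)%:R * (K * r2 ^+ n.+1 * K)) =
    n.+1%:R * ((ball_card o n)%:R * (K * r2 * K)) * r2 ^+ n.
  by rewrite exprS; ring.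
near: n; apply: (subexponential_absorb (s := fun n =>
  n.+1%:R * ((ball_card o n)%:R * (K * r2 * K)))) => //.
have c0 : 0 <= K * r2 * K by rewrite !mulr_ge0// ltW.
apply: subexponentialM => //; first by move=> n; rewrite mulr_ge0.
  exact: subexponential_succ.
by apply: subexponentialM => //; exact: subexponential_cst.
Unshelve. all: by end_near. Qed.

End WalkGrowth.

(** * Polygons *)

Section CycleEdges.
Variable G : graph.
Implicit Types (x y z o : G) (p q c : seq G) (n i j : nat).

(** With default value [x], the successor rule also covers the last vertex,
    whose successor is the first vertex [x]. *)
Lemma next_uniq x p i : uniq (x :: p) -> (i < size (x :: p))%N ->
  next (x :: p) (nth x (x :: p) i) = nth x (x :: p) i.+1.
Proof. by move=> up ip; rewrite next_nth mem_nth// index_uniq. Qed.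

Lemma cycle_edgesP c (E : {fset G}) :
  reflect (exists2 x, x \in c & E = [fset x;
    next c x]%fset) (E \in cycle_edges c).
Proof.
apply: (iffP idP) => [/imfsetP[x /= xc ->]|[x xc ->]]; first by exists x.
by apply/imfsetP; exists x.
Qed.

(** The edges determine a cycle once its first step is known: the vertex after
    [B] is the neighbour of [B] other than the vertex before [B]. *)
Lemma cycle_edges_inj x y p q : uniq (x :: y :: p) -> uniq (x :: y :: q) ->
  size p = size q ->
  cycle_edges (x :: y :: p) = cycle_edges (x :: y :: q) -> p = q.
Proof.
set c := x :: y :: p; set d := x :: y :: q => uc ud pq E.
have szcd : size c = size d by rewrite /= pq.
have step i : nth x c i = nth x d i /\ nth x c i.+1 = nth x d i.+1.
  elim: i => [//|i [IH0 IH1]]; split=> //.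
  have [ilt|ige] := ltnP i.+2 (size c); last by rewrite !nth_default// -szcd.
  have i1lt : (i.+1 < size c)%N by exact: ltn_trans ilt.
  have i0lt : (i < size c)%N by exact: ltn_trans i1lt.
  have neq j k : (j < size c)%N -> (k < size c)%N -> j != k ->
      nth x c j != nth x c k by move=> jc kc; rewrite nth_uniq.
  have : [fset nth x c i.+1; nth x c i.+2]%fset \in cycle_edges d.
    rewrite -E; apply/cycle_edgesP; exists (nth x c i.+1); first exact: mem_nth.
    by rewrite next_uniq.
  move=> /cycle_edgesP[z zd]; rewrite -(nth_index x zd).
  have jd : (index z d < size d)%N by rewrite index_mem.
  move: (index z d) jd => j jd; rewrite next_uniq// => Ej.
  have BD : nth x c i.+2 != nth x c i.+1 by rewrite neq// gtn_eqF.
  have : nth x c i.+1 \in [fset nth x d j; nth x d j.+1]%fset.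
    by rewrite -Ej !inE eqxx.
  have : nth x c i.+2 \in [fset nth x d j; nth x d j.+1]%fset.
    by rewrite -Ej !inE eqxx orbT.
  rewrite !inE => Dj /orP[]; rewrite IH1 => /eqP Bj.
    have ij : i.+1 = j.
      by apply/eqP; rewrite -(nth_uniq x _ jd ud) -?szcd// Bj.
    by move: Dj; rewrite -ij -IH1 (negbTE BD) => /eqP.
  have [j1|j1] := ltnP j.+1 (size d); last first.
    have := neq i.+1 0%N i1lt (ltn_trans (ltn0Sn _) i1lt) isT.
    by rewrite IH1 Bj nth_default// eqxx.
  have ij : i = j.
    by apply/eqP; rewrite -eqSS -(nth_uniq x _ j1 ud) -?szcd// Bj.
  move: Dj; rewrite -ij -IH1 (negbTE BD) orbF -IH0 => Dj.
  by have := neq i.+2 i ilt i0lt; rewrite Dj => /(_ _)/negP[]//;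
    rewrite gtn_eqF.
apply: (@eq_from_nth _ x) => // i _; have [_] := step i.+1; exact.
Qed.

Lemma cycle_edges_rot c i : uniq c -> cycle_edges (rot i c) = cycle_edges c.
Proof.
move=> uc; apply/fsetP => E; apply/cycle_edgesP/cycle_edgesP => -[x].
  by rewrite mem_rot next_rot// => xc ->; exists x.
by move=> xc ->; exists x; rewrite ?mem_rot ?next_rot.
Qed.

Lemma polygons_sub_saws o n :
  polygons o n `<=` (fun p => cycle_edges (o :: p)) @` saws o n.-1.
Proof.
move=> _ [c [n3 cn uc cc [oc ->]]]; have [i p rE] := rot_to oc.
exists p; last by rewrite -rE cycle_edges_rot.
split; last by rewrite -rE rot_uniq.
- by rewrite -cn -(size_rot i c) rE.
- by move: cc; rewrite -(rot_cycle i) rE /= rcons_path => /andP[].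
Qed.

Lemma finite_polygons o n : locally_finite G -> finite_set (polygons o n).
Proof.
move=> lf; apply: sub_finite_set (@polygons_sub_saws o n) _.
by apply: finite_image; exact: finite_saws.
Qed.

Lemma polygons_le_saws o n : locally_finite G ->
  (ncard (polygons o n) <= ncard (saws o n.-1))%N.
Proof.
move=> lf; have fs := finite_saws lf o n.-1.
apply: leq_trans (ncard_image_le _ fs).
by apply: ncard_subset (@polygons_sub_saws o n); exact: finite_image.
Qed.

End CycleEdges.

(** A forward orbit inside a finite set would be finite, and [f], being
    injective, would permute it. *)
Lemma translation_escapes (T : choiceType) (f : T -> T) (x : T) (B : set T) :
  injective f -> finite_set B ->
  ~ (exists F : set T, [/\ finite_set F, F !=set0 & f @` F = F]) ->
  exists k, ~ B (iter k f x).
Proof.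
move=> finj finB nF; apply: contrapT => /forallNP inB; apply: nF.
pose F := [set iter k f x | k in [set: nat]].
have finF : finite_set F.
  by apply: sub_finite_set finB => _ [k _ <-]; have := inB k => /contrapT.
exists F; split=> //; first by exists x, 0%N.
have fF : f @` F `<=` F by move=> _ [_ [k _ <-] <-]; exists k.+1.
apply: fset_set_inj => //; first exact: finite_image.
apply/eqP; rewrite eqEfcard; apply/andP; split.
  by rewrite -fset_set_sub//; exact: finite_image.
by rewrite fset_set_image// card_imfset.
Qed.

Section PolygonConstruction.
Variables (G : graph) (o : G) (H : set (G -> G)) (h : G -> int).
Hypothesis hs : height_structure H h.
Variables (a sg : G -> G) (n : nat).
Hypotheses (Ha : H a) (n0 : (0 < n)%N) (Hsg : H sg).
Hypothesis hsg : forall v, h (sg v) = h v.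
Hypothesis sgC : forall f, H f -> f \o sg = sg \o f.
(** In particular, walks of [n] steps from [o] and from [sg o] do not meet. *)
Hypothesis far : forall p, path (@adj G) o p -> last o p = sg o -> (n + n < size p)%N.
Implicit Types (u v w x y z : G) (p q s : seq G) (N : nat).

Let aH := hs_aut hs.

(** Each period leads from [o] to [a o], and [map a] moves the rest of the chain
    to start there, so chains are bridges from [o] to [iter N a o]. *)
Fixpoint chains N : set (seq G) :=
  if N is N'.+1 then [set p ++ map a q | p in periods h o a n & q in chains N']
  else [set [::]].

Lemma finite_periods : finite_set (periods h o a n).
Proof. by apply: finite_setIl; exact: finite_bridges (hs_fin hs) _ _ _. Qed.

Lemma finite_chains N : finite_set (chains N).
Proof.
elim: N => [|N IH]; first exact: finite_set1.
by apply: finite_image2 => //; exact: finite_periods.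
Qed.

Lemma chains_card N : (ncard (periods h o a n) ^ N <= ncard (chains N))%N.
Proof.
elim: N => [|N IH]; first by rewrite /ncard fset_set1 cardfs1.
rewrite expnS; apply: (@leq_trans (ncard (periods h o a n) * ncard (chains N))).
  by rewrite leq_mul2l IH orbT.
apply: (ncardX_inj (f := fun pq : seq G * seq G => pq.1 ++ map a pq.2)).
- exact: finite_periods.
- exact: finite_chains.
- exact: finite_chains N.+1.
- by move=> p q Pp Cq; exists p => //; exists q.
move=> p q p' q' [[[pn _ _] _] _] _ [[[pn' _ _] _] _] _ /= /eqP.
rewrite eqseq_cat ?pn// => /andP[/eqP -> /eqP].
by move/(inj_map (aut_inj aH Ha)).
Qed.

Lemma chain_bridge N q : chains N q ->
  bridges h o (N * n) q /\ last o q = iter N a o.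
Proof.
elim: N q => [|N IH] q /=.
  by move=> ->; split=> //; split.
move=> [p [bp pa] [s /IH[bs sl] <-]]; rewrite /= in pa.
split; last by rewrite last_cat pa last_map sl.
by rewrite mulSn; apply: bridge_cat => //; rewrite pa;
  exact: (bridge_map hs Ha bs).
Qed.

(** Pieces at the same level stay within distance [n] of [o] and [sg o], up to a
    common power of [a]; pieces at different levels differ in height. *)
Lemma chains_disjoint N q q' x y : chains N q -> chains N q' ->
  x \in o :: q -> y \in o :: q' -> x <> sg y.
Proof.
elim: N q q' x y => [|N IH] q q' x y /=.
  move=> -> ->; rewrite !inE => /eqP -> /eqP -> so.
  by have := far (p := [::]) isT so.
move=> [p [bp pa] [s Cs <-]] [p' [bp' pa'] [s' Cs' <-]]; rewrite /= in pa pa'.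
have low r z : bridges h o n r -> last o r = a o -> z \in o :: r -> h z <= h (a o).
  move=> [_ hr] ra; rewrite inE -ra => /predU1P[->|/hr/andP[]//].
  by case: (r) hr => //= z' r' /(_ _ (mem_last z' r'))/andP[/ltW].
have high r z : chains N r -> z \in map a r -> h (a o) < h z.
  move=> /chain_bridge[br _]; have [_ hr] := bridge_map hs Ha br.
  by move=> /hr/andP[].
have reach r z : bridges h o n r -> z \in o :: r -> exists e,
    [/\ path (@adj G) o e, last o e = z & (size e <= n)%N].
  move=> [[rn or _] _] zr; move: rn or; case/splitPl: zr => e e' wz.
  rewrite size_cat cat_path => wn /andP[ow _]; exists e.
  by rewrite wz; split=> //; rewrite -wn leq_addr.
rewrite -!cat_cons !mem_cat => /orP[xp|xs] /orP[yp|ys] xy.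
- have [e [ow wx wn]] := reach _ _ bp xp.
  have [e' [ow' wy wn']] := reach _ _ bp' yp.
  have [rp rl] := path_rev ow'; rewrite wy in rp rl.
  have : (n + n < size (e ++ map sg (rev (belast o e'))))%N.
    apply: far; first by rewrite cat_path ow wx xy (aut_path aH).
    by rewrite last_cat wx xy last_map rl.
  rewrite size_cat size_map size_rev size_belast ltnNge => /negP[].
  exact: leq_add.
- have := low _ _ bp pa xp; have := high _ _ Cs' ys; rewrite xy hsg; lia.
- have := low _ _ bp' pa' yp; have := high _ _ Cs xs; rewrite xy hsg; lia.
move: xs ys xy => /mapP[x' xs ->] /mapP[y' ys ->].
have /(congr1 (@^~ y')) /= <- := sgC Ha => /(aut_inj aH Ha).
by apply: IH Cs Cs' _ _; rewrite inE ?xs ?ys orbT.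
Qed.

(** Two chains, the second shifted by [sg], are joined below their start and
    above their end. All these polygons share the lower joint, so their first
    step is the same and [cycle_edges_inj] applies. *)
Lemma polygons_from_chains : exists2 l, (0 < l)%N & forall N, (0 < N)%N ->
  (ncard (periods h o a n) ^ N * ncard (periods h o a n) ^ N <=
   ncard (polygons o (N * n + N * n + l)))%N.
Proof.
(* [t] is the interior of the upper joint, before its translation by [a ^ N];
   the lower joint [d] includes its endpoint [sg o]. *)
have [t [ot ut ht]] := over_path hs o Hsg hsg sgC.
have [b [ob ub hb]] : exists p, [/\ path (@adj G) o (rcons p (sg o)), uniq p &
    forall z, z \in p -> - h o < - h z].
  by apply: (over_path (height_structureN hs)) => // v; rewrite hsg.
pose d := rcons b (sg o).
have hd z : z \in d -> h z <= h o.
  by rewrite mem_rcons inE => /predU1P[->|/hb]; rewrite ?hsg//; lia.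
exists (size d + size t).+1 => // N N0.
pose aN := iter N a; have HaN : H aN by exact: aut_iter.
apply: (@leq_trans (ncard (chains N) * ncard (chains N))).
  by apply: leq_mul; exact: chains_card.
pose cyc q q' := o :: d ++ map sg q' ++ rev (q ++ map aN t).
have od : uniq (o :: d).
  rewrite /d cons_uniq rcons_uniq ub mem_rcons inE negb_or andbT.
  rewrite -andbA; apply/and3P; split.
  - by apply/eqP => so; have := far (p := [::]) isT so.
  - by apply/negP => /hb; rewrite ltxx.
  - by apply/negP => /hb; rewrite hsg ltxx.
have hchain q z : chains N q -> z \in q -> h o < h z /\ h z <= h (aN o).
  by move=> /chain_bridge[[_ hq] ql] /hq /andP; rewrite /aN -ql.
have hend q : chains N q -> h o <= h (aN o).
  move=> /chain_bridge[[_ hq] ql]; rewrite /aN -ql.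
  case: q hq {ql} => //= z q /(_ _ (mem_last z q)).
  by move=> /andP[/ltW].
have htop z : z \in map aN t -> h (aN o) < h z.
  move=> /mapP[{}z /ht zt ->]; have := hs_diff hs o z HaN; lia.
have cyc_uniq q q' : chains N q -> chains N q' -> uniq (cyc q q').
  move=> Cq Cq'; rewrite /cyc -cat_cons cat_uniq od /=; have := hend q Cq => oN.
  have [[[_ _ uq] _] _] := chain_bridge Cq.
  have [[[_ _ uq'] _] _] := chain_bridge Cq'.
  apply/andP; split.
    apply/hasPn => z; rewrite mem_cat mem_rev mem_cat => zin; apply/negP.
    rewrite inE => /predU1P zd.
    have zo : h z <= h o by case: zd => [->|/hd].
    case/or3P: zin => [/mapP[x /(hchain _ _ Cq') ? zx]|/(hchain _ _ Cq)|/htop];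
      last 2 first.
    - by lia.
    - by lia.
    by move: zo; rewrite zx hsg; lia.
  rewrite cat_uniq map_inj_uniq; last exact: (aut_inj aH Hsg).
  rewrite rev_uniq cat_uniq map_inj_uniq; last exact: (aut_inj aH HaN).
  move: uq uq'; rewrite !cons_uniq ut => /andP[_ ->] /andP[_ ->];
    rewrite andbT /=.
  apply/andP; split; apply/hasPn => z.
    rewrite mem_rev mem_cat => zin; apply/negP => /mapP[x xq' zx].
    case/orP: zin => [zq|/htop]; last first.
      by have := hchain _ _ Cq' xq'; rewrite zx hsg; lia.
    by apply: (chains_disjoint Cq Cq' _ _ zx); rewrite inE ?zq ?xq' orbT.
  by move=> /htop zt; apply/negP => /(hchain _ _ Cq); lia.
have cyc_cycle q q' : chains N q -> chains N q' -> cycle (@adj G) (cyc q q').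
  move=> Cq Cq'; have [[[_ oq _] _] ql] := chain_bridge Cq.
  have [[[_ oq' _] _] ql'] := chain_bridge Cq'.
  rewrite /cyc /= !rcons_cat !cat_path ob last_rcons (aut_path aH)// oq' /=.
  rewrite last_map ql'.
  have [] := @path_rev _ o (q ++ map aN (rcons t (sg o))).
    by rewrite cat_path oq ql -/aN (aut_path aH).
  rewrite map_rcons -rcons_cat last_rcons belast_rcons rev_cons -/aN.
  by have /(congr1 (@^~ o)) /= -> := sgC HaN.
have cyc_size q q' : chains N q -> chains N q' ->
    size (cyc q q') = (N * n + N * n + (size d + size t).+1)%N.
  move=> /chain_bridge[[[qn _ _] _] _] /chain_bridge[[[qn' _ _] _] _].
  by rewrite /cyc /= size_cat size_cat size_rev size_cat !size_map qn qn'; lia.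
apply: (ncardX_inj (f := fun qq => cycle_edges (cyc qq.1 qq.2))).
- exact: finite_chains.
- exact: finite_chains.
- exact: finite_polygons (hs_fin hs).
- move=> q q' Cq Cq'; exists (cyc q q'); split.
  + have d0 : (0 < size d)%N by rewrite size_rcons.
    have Nn0 : (0 < N * n)%N by rewrite muln_gt0 N0.
    by rewrite addnS ltnS (@leq_add 1 1)// addn_gt0 ?Nn0 ?d0.
  + exact: cyc_size.
  + exact: cyc_uniq.
  + exact: cyc_cycle.
  + by rewrite mem_head.
move=> q q' s s' Cq Cq' Cs Cs' /=.
have [uq us] := (cyc_uniq _ _ Cq Cq', cyc_uniq _ _ Cs Cs').
have sz : size (cyc q q') = size (cyc s s') by rewrite !cyc_size.
have [y [d' dE]] : exists y d', d = y :: d'.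
  by rewrite /d; case: (b) => [|y b'];
    [exists (sg o), [::]|exists y, (rcons b' (sg o))].
move: uq us sz; rewrite /cyc dE => uq us [sz] /(cycle_edges_inj uq us sz)/eqP.
have [[[[qn _ _] _] _] [[[sn _ _] _] _]] := (chain_bridge Cq, chain_bridge Cs).
have [[[[qn' _ _] _] _] [[[sn' _ _] _] _]] := (chain_bridge Cq', chain_bridge Cs').
rewrite eqseq_cat// eqxx /= eqseq_cat ?size_map ?qn' ?sn'// => /andP[/eqP qs' /eqP].
move/(can_inj revK)/eqP; rewrite eqseq_cat ?qn ?sn// => /andP[/eqP -> _].
by split=> //; move: qs' => /(inj_map (aut_inj aH Hsg)).
Qed.
End PolygonConstruction.

(** * Rates of polygons and the theorem *)

Lemma subexponential_ball (R : realType) (G : graph) (o : G) :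
  connected_graph G -> locally_finite G -> subexponential_growth R o ->
  subexponential (fun n => (ball_card o n)%:R : R).
Proof.
move=> Gconn Glf sub q q1.
have q0 : 0 < q by exact: lt_trans q1.
near=> n; have n0 : (0 < n)%N by near: n; exact: nbhs_infty_gt.
have B0 : 0 < (ball_card o n)%:R :> R by rewrite ltr0n ball_card_gt0.
rewrite -ler_ln ?posrE ?exprn_gt0// lnXn// -[leRHS]mulr_natl.
rewrite -ler_pdivrMl ?ltr0n//; apply: le_trans (ler_norm _) _; near: n.
by have /cvgr0_norm_le := sub; apply; exact: ln_gt0.
Unshelve. all: by end_near. Qed.

Lemma arithmetic_ge (m : nat -> nat) N : positive_arithmetic_sequence m ->
  (N <= m N)%N.
Proof.
move=> [d d0 mP]; case: N => // N; elim: N => [|N IH].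
  by have [] := mP 1%N isT.
by have [_ ->] := mP N.+1 isT; rewrite -addn1 leq_add.
Qed.

(** A power of [rho] moves [o] too far for a chain to meet its shifted partner.
    Joining the two chains costs the same number of steps for every number [N]
    of periods, so as [N] grows the polygons inherit the rate of the periods. *)
Lemma polygon_rate (R : realType) (G : graph) (o : G) (H : set (G -> G))
    (h : G -> int) (rho : G -> G) (b r : R) :
  height_structure H h -> H rho -> translation rho ->
  (forall v, h (rho v) = h v) -> (forall f, H f -> f \o rho = rho \o f) ->
  subexponential (fun n => (ball_card o n)%:R : R) ->
  growth_rate (fun n => ncard (bridges h o n)) b -> 0 < r -> r < b ->
  exists2 m, positive_arithmetic_sequence m &
    \forall N \near \oo, r ^+ m N <= (ncard (polygons o (m N)))%:R.
Proof.
move=> hs Hrho trho hrho rhoC sub [_ lb] r0 rb; have aH := hs_aut hs.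
pose q := (r + b) / 2; pose s := (r + q) / 2.
have rs : r < s by rewrite /s /q; lra.
have sq : s < q by rewrite /s /q; lra.
have qb : q < b by rewrite /q; lra.
have s0 : 0 < s by lra.
have [c cP] := many_periods hs o.
have /filter_ex[n [qn snq n0]] : \forall n \near \oo,
    [/\ q ^+ n <= (ncard (bridges h o n))%:R,
    (ball_card o (n + c))%:R * (c.+1%:R * (1 + s) ^+ c) * s ^+ n <= q ^+ n &
    (0 < n)%N].
  near=> n; split.
  - by near: n; apply: lb => //; lra.
  - near: n; apply: (subexponential_absorb (s := fun n =>
        (ball_card o (n + c))%:R * (c.+1%:R * (1 + s) ^+ c))) => //.
    apply: subexponentialM => //.
    + by move=> _; rewrite mulr_ge0// exprn_ge0//; lra.
    + exact: (subexponential_shift c sub).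
    + exact: subexponential_cst.
  - by near: n; exact: nbhs_infty_gt.
have [a [n' [Ha /andP[nn' n'n] bn]]] := cP n.
have n'0 : (0 < n')%N by exact: leq_trans nn'.
pose P := ncard (periods h o a n').
have sP : s ^+ n' <= P%:R.
  have B0 : 0 < (ball_card o (n + c) * c.+1)%:R :> R.
    by rewrite ltr0n muln_gt0 ball_card_gt0//;
      [exact: hs_conn hs|exact: hs_fin hs].
  rewrite -(ler_pM2l B0); rewrite -(ler_nat R) natrM in bn.
  apply: le_trans bn; apply: le_trans qn; apply: le_trans snq.
  rewrite natrM -!mulrA; do 2 rewrite ler_wpM2l//.
  rewrite -(subnKC nn') exprD mulrC ler_wpM2r ?exprn_ge0 ?(ltW s0)//.
  apply: (@le_trans _ _ ((1 + s) ^+ (n' - n))).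
    by rewrite lerXn2r ?nnegrE//; lra.
  by rewrite ler_weXn2l// ?leq_subLR//; lra.
have finB := finite_ball (hs_conn hs) (hs_fin hs) o (n' + n').
(* Beyond distance [2 * n'], walks of [n'] steps from both points are
   disjoint. *)
have [k kB] := translation_escapes o (aut_inj aH Hrho) finB trho.
pose sg := iter k rho.
have Hsg : H sg by exact: aut_iter.
have hsg v : h (sg v) = h v.
  by rewrite /sg; elim: (k) => //= j IH; rewrite hrho.
have sgC f : H f -> f \o sg = sg \o f.
  move=> Hf; apply/funext => v; rewrite /sg /=.
  elim: (k) => //= j <-.
  by have /(congr1 (@^~ (iter j rho v))) /= := rhoC f Hf.
have far p : path (@adj G) o p -> last o p = sg o -> (n' + n' < size p)%N.
  move=> op pE; rewrite ltnNge; apply/negP => pn; apply: kB => /=.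
  by rewrite -/sg -pE; apply: leq_trans (graph_dist_le op) pn.
have [l l0 lP] := polygons_from_chains hs Ha n'0 Hsg hsg sgC far.
exists (fun N => N * n' + N * n' + l)%N.
  exists (n' + n')%N; first by rewrite addn_gt0 n'0.
  by move=> N N1; split; [rewrite addn_gt0 l0 orbT|rewrite !mulSn; lia].
have nE N : (N * n' + N * n' = (n' + n') * N)%N by lia.
near=> N; have N0 : (0 < N)%N by near: N; exact: nbhs_infty_gt.
apply: (@le_trans _ _ (P ^ N * P ^ N)%:R); last by rewrite ler_nat lP.
have sN : (s ^+ (n' + n')) ^+ N <= (P ^ N * P ^ N)%:R.
  have sn0 : 0 <= s ^+ n' by rewrite exprn_ge0// ltW.
  have sNP : (s ^+ n') ^+ N <= P%:R ^+ N by rewrite lerXn2r// nnegrE.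
  rewrite exprD exprMn natrM natrX; apply: ler_pM => //; exact: exprn_ge0.
apply: le_trans sN; rewrite exprD mulrC.
rewrite nE exprM; near: N; apply: (subexponential_absorb (s := fun=> r ^+ l)).
- exact: subexponential_cst.
- exact: exprn_gt0.
- by rewrite ltrXn2r ?(ltW r0)// -lt0n addn_gt0 n'0.
Unshelve. all: by end_near. Qed.

Theorem theorem3p2 (R : realType) (G : graph) (o : G)
    (h : G -> int) (H : set (G -> G)) (rho : G -> G)
    (Ginf : infinite_set [set: G])
    (Gconn : connected_graph G)
    (Glf : locally_finite G)
    (Gqt : quasi_transitive G)
    (hsq : square_graph_height_function o h H rho)
    (Gsub : subexponential_growth R o) :
  (polygon_constant R o = (bridge_constant R o h H)%:E /\
   bridge_constant R o h H = connective_constant R o) /\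
  (forall eps : R, 0 < eps ->
    exists2 m : nat -> nat, positive_arithmetic_sequence m &
      ((bridge_constant R o h H - eps)%:E <=
         limn_einf (fun N => (polygon_root R o (m N))%:E))%E).
Proof.
have [[_ aH fin hdiff hupdown] Hrho trho hrho rhoC] := hsq.
have hs : height_structure H h.
  split=> // v; have [u [w [vu vw huv hvw]]] := hupdown v; first by exists w.
  by exists u; rewrite ltrN2.
have hsN := height_structureN hs.
have NN : (fun v => - - h v) = h by apply/funext => v; rewrite opprK.
have sub := subexponential_ball Gconn Glf Gsub.
have [b [b1 gb ub]] := bridge_rate_exists R o hs.
have [b' [b'1 gb' ub']] := bridge_rate_exists R o hsN.
have bb' : b' = b.
  apply/eqP; rewrite eq_le; apply/andP; split.
    by apply: (bridge_rate_le sub hsN gb' b1); rewrite NN.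
  exact: (bridge_rate_le sub hs gb b'1).
rewrite bb' in gb' ub' b'1; have b0 : 0 < b by exact: lt_le_trans b1.
have saws_ub : forall r, b < r -> \forall n \near \oo, (ncard (saws o n))%:R <= r ^+ n.
  by apply: (saws_growth_le hs sub b1) => -[].
have gs : growth_rate (fun n => ncard (saws o n)) b.
  split=> // r r0 rb; have [N _ NP] := gb.2 r r0 rb;
    exists N => // n /NP /le_trans.
  apply; rewrite ler_nat; apply: ncard_subset; first exact: finite_saws.
  by move=> p [].
have cE : connective_constant R o = b by exact: growth_rate_limn.
have bE : bridge_constant R o h H = b.
  have hE : bridge_growth R o h = b by exact: growth_rate_limn.
  have hNE : bridge_growth R o (fun v => - h v) = b by exact: growth_rate_limn.
  by rewrite /bridge_constant hE hNE maxxx; case: ifP.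
have poly_lb eps : 0 < eps -> exists2 m, positive_arithmetic_sequence m &
    \forall N \near \oo, b - eps <= polygon_root R o (m N).
  move=> e0; pose r := Num.max (b - eps) (b / 2).
  have r0 : 0 < r by rewrite lt_max; apply/orP; right; rewrite divr_gt0.
  have rb : r < b by rewrite gt_max ltrBlDr ltrDl e0 /= ltr_pdivrMr//; lra.
  have [m mP [N0 _ NP]] := polygon_rate hs Hrho trho hrho rhoC sub gb r0 rb.
  exists m => //; exists N0.+1 => // N /= N0N.
  apply: (@le_trans _ _ r); first by rewrite le_max lexx.
  apply: nroot_ge; [|exact: ltW|exact: (NP N (ltnW N0N))].
  apply: leq_trans (arithmetic_ge N mP); exact: leq_trans N0N.
rewrite bE cE; split; first split=> //.
  apply/eqP; rewrite eq_le; apply/andP; split; apply/lee_addgt0Pr => e e0.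
    apply: limn_esup_le; have br : b < b + e by rewrite ltrDl.
    have [N _ NP] := saws_ub _ br; exists N.+1 => // n /= Nn.
    rewrite -EFinD lee_fin; have n0 : (0 < n)%N by exact: leq_trans Nn.
    apply: nroot_le => //; first by lra.
    have := polygons_le_saws o n Glf; rewrite -(ler_nat R) => /le_trans; apply.
    apply: le_trans (NP n.-1 _) _; first by rewrite /= -ltnS prednK.
    by rewrite ler_weXn2l ?leq_pred//; lra.
  rewrite -leeBlDr// -EFinB; have [m mP [N0 _ NP]] := poly_lb e e0.
  apply: le_limn_esup => N; exists (m (maxn N N0)).
    by apply: leq_trans (arithmetic_ge _ mP); exact: leq_maxl.
  by rewrite lee_fin NP//= leq_maxr.
move=> e e0; have [m mP NP] := poly_lb e e0; exists m => //.
by apply: le_limn_einf; apply: filterS NP => N; rewrite lee_fin.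
Qed.
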